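(* Let $K$ be a number field whose ring of integers $\mathcal{O}_K$ is a principal ideal domain, and let $\phi(z)\in K(z)$ be a rational map of degree $2$. Then $\phi$ has potential good reduction if and only if $[\phi]\in M_2(\mathcal{O}_K)$.
   Context: Conjugation: for $f\in\mathrm{PGL}_2$, $\phi^f=f^{-1}\circ\phi\circ f$. Good reduction: let $L$ be a number field, $\psi\in L(z)$ and $\mathfrak{p}$ a nonzero prime ideal of $\mathcal{O}_L$. Write $\psi=F/G$ with all coefficients of $F,G$ $\mathfrak{p}$-integral and at least one a $\mathfrak{p}$-adic unit; $\psi$ has good reduction at $\mathfrak{p}$ if the rational map $\tilde\psi$ obtained by reducing the coefficients modulo $\mathfrak{p}$ (and cancelling common factors) satisfies $\deg\tilde\psi=\deg\psi$; equivalently, the resultant of the degree-$d$ homogenizations of $F,G$ (where $d=\deg\psi$) is a $\mathfrak{p}$-adic unit. $\psi$ has good reduction over $L$ if it has good reduction at every nonzero prime ideal of $\mathcal{O}_L$. A map $\phi\in K(z)$ has potential good reduction if there is $f\in\mathrm{PGL}_2(\bar K)$ such that $\phi^f$ is defined over, and has good reduction over, a finite extension of $K$. Multipliers: the multiplier of $\phi$ at a finite fixed point $\alpha$ is $\phi'(\alpha)$ (at $\infty$, it is computed after a change of coordinates moving $\infty$ to a finite point). A degree $2$ map has three fixed points in $\mathbb{P}^1(\bar K)$ counted with multiplicity, with multipliers $\lambda_1,\lambda_2,\lambda_3$. Let $\sigma_1=\lambda_1+\lambda_2+\lambda_3$ and $\sigma_2=\lambda_1\lambda_2+\lambda_1\lambda_3+\lambda_2\lambda_3$;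 these lie in $K$. Moduli space: $M_2=\mathrm{Rat}_2/\mathrm{PGL}_2$ is the moduli space of degree $2$ rational maps on $\mathbb{P}^1$ modulo conjugation; $M_2\cong\mathbb{A}^2$ with coordinates $(\sigma_1,\sigma_2)$. $[\phi]$ is the point of $M_2$ given by $\phi$, and $[\phi]\in M_2(\mathcal{O}_K)$ means $\sigma_1,\sigma_2\in\mathcal{O}_K$. *)

(* Defs.v *)
From HB Require Import structures.
From mathcomp Require Import all_boot all_order all_algebra all_field.
From mathcomp Require Import boolp.

Set Implicit Arguments.
Unset Strict Implicit.
Unset Printing Implicit Defensive.

Import GRing.Theory.
Local Open Scope ring_scope.
Local Open Scope quotient_scope.

(* A number field is a [fieldExtType rat]. The definitions that only use the  *)
(* field structure are stated over an arbitrary [fieldType].                  *)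

Section RingOfIntegers.
Variable L : fieldType.

Definition algint : {pred L} :=
  fun x => `[< integralOver (intr : int -> L) x >].

Fact algint_subring_closed : subring_closed algint.
Proof.
split=> [|x y /asboolP Ix /asboolP Iy|x y /asboolP Ix /asboolP Iy];
  apply/asboolP.
- exact: (integral1 (intr : {rmorphism int -> L})).
- exact: (integral_sub (RtoK := (intr : {rmorphism int -> L}))).
- exact: (integral_mul (RtoK := (intr : {rmorphism int -> L}))).
Qed.

HB.instance Definition _ :=
  GRing.isSubringClosed.Build L algint algint_subring_closed.

Record ring_of_integers : predArgType :=
  RingInt { int_val :> L; int_valP : int_val \in algint }.

HB.instance Definition _ := [isSub for int_val].
HB.instance Definition _ := [Choice of ring_of_integers by <:].
HB.instance Definition _ :=
  [SubChoice_isSubComNzRing of ring_of_integers by <:].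

End RingOfIntegers.

(* The library's [idealr] only covers proper ideals, hence the closure        *)
(* conditions are spelled out. Integrality of the ring is not included, as    *)
(* [principal_ideal_ring] is only applied to subrings of fields.              *)
Definition principal_ideal_ring (R : comNzRingType) : Prop :=
  forall I : {pred R},
    zmod_closed I -> (forall a x, x \in I -> a * x \in I) ->
  exists g, forall x, x \in I <-> exists a, x = a * g.

Section ResidueField.
Variables (R : comNzRingType) (P : prime_idealr R).

Definition residue_ring : Type := {ideal_quot P}.

HB.instance Definition _ := GRing.ComNzRing.on residue_ring.

Definition residue_unit : pred residue_ring :=
  fun x => `[< exists y, y * x = 1 >].

Definition residue_inv (x : residue_ring) : residue_ring :=
  if pselect (exists y, y * x = 1) is left xV then sval (cid xV) else x.

Fact residue_mulVx : {in residue_unit, left_inverse 1 residue_inv *%R}.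
Proof.
move=> x /asboolP xV; rewrite /residue_inv.
by case: pselect => // xV'; case: cid.
Qed.

Fact residue_unitPl x y : y * x = 1 -> residue_unit x.
Proof. by move=> yx1; apply/asboolP; exists y. Qed.

Fact residue_inv_out : {in [predC residue_unit], residue_inv =1 id}.
Proof.
move=> x /asboolPn nxV; rewrite /residue_inv.
by case: pselect.
Qed.

HB.instance Definition _ :=
  GRing.ComNzRing_hasMulInverse.Build residue_ring
    residue_mulVx residue_unitPl residue_inv_out.

Fact residue_idomain (x y : residue_ring) :
  x * y = 0 -> (x == 0) || (y == 0).
Proof. exact: (@Quotient.rquot_IdomainAxiom R P). Qed.

HB.instance Definition _ :=
  GRing.ComUnitRing_isIntegral.Build residue_ring residue_idomain.

Definition residue_class (a : R) : residue_ring := \pi_{ideal_quot P} a.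

(* When R is the ring of integers of a number field and P is nonzero, R / P   *)
(* is already a field and equals its field of fractions.                      *)
Definition residue_field : fieldType := {fraction residue_ring}.

End ResidueField.

Section Localization.
Variables (L : fieldType) (P : prime_idealr (ring_of_integers L)).

Definition p_integral (x : L) : Prop :=
  exists2 ab : ring_of_integers L * ring_of_integers L,
    ab.2 \notin P & x = val ab.1 / val ab.2.

Definition p_unit (x : L) : Prop :=
  exists2 ab : ring_of_integers L * ring_of_integers L,
    (ab.1 \notin P) && (ab.2 \notin P) & x = val ab.1 / val ab.2.

(* For x = a / b with b not in P this is (a mod P) / (b mod P), whatever the  *)
(* representation chosen; elements that are not P-integral are sent to 0.     *)
Definition reduction (x : L) : residue_field P :=
  if pselect (p_integral x) is left intx then
    let ab := s2val (cid2 intx) in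
    tofrac (residue_class P ab.1)
      / tofrac (residue_class P ab.2)
  else 0.

End Localization.

(* Rational maps over K, as elements of K(z) = {fraction {poly K}}.           *)
Section RationalMaps.
Variable K : fieldType.

(* Degree of the rational map [F : G], after cancelling common factors; the   *)
(* case G = 0 (the constant map infinity) is allowed and has degree 0.        *)
Definition pair_degree (F G : {poly K}) : nat :=
  (maxn (size (F %/ gcdp F G)) (size (G %/ gcdp F G))).-1.

Implicit Types phi psi : {fraction {poly K}}.

(* Numerator and denominator in lowest terms, up to a common nonzero scalar.  *)
Definition rnum phi : {poly K} :=
  \n_(repr phi) %/ gcdp \n_(repr phi) \d_(repr phi).
Definition rden phi : {poly K} :=
  \d_(repr phi) %/ gcdp \n_(repr phi) \d_(repr phi).

Definition rdegree phi : nat := pair_degree (rnum phi) (rden phi).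

Definition reval phi (a : K) : K := (rnum phi).[a] / (rden phi).[a].

Definition rderiv phi : {fraction {poly K}} :=
  tofrac ((rnum phi)^`() * rden phi - rnum phi * (rden phi)^`())
    / tofrac (rden phi ^+ 2).

Definition peval (F : {poly K}) psi : {fraction {poly K}} :=
  (map_poly (fun c => tofrac c%:P) F).[psi].

(* phi \o psi; meaningful unless psi is a constant map whose value is a pole  *)
(* of phi, which does not happen in [rconj] for a nonconstant phi.            *)
Definition rcomp phi psi : {fraction {poly K}} :=
  peval (rnum phi) psi / peval (rden phi) psi.

(* The element z |-> (a z + b) / (c z + d) of PGL_2 given by an invertible    *)
(* matrix [a b; c d].                                                         *)
Definition mobius (M : 'M[K]_2) : {fraction {poly K}} :=
  tofrac (M 0 0 *: 'X + (M 0 1)%:P)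
    / tofrac (M 1 0 *: 'X + (M 1 1)%:P).

Definition rconj (M : 'M[K]_2) phi : {fraction {poly K}} :=
  rcomp (mobius (invmx M)) (rcomp phi (mobius M)).

Definition inversion : 'M[K]_2 := \matrix_(i, j) (i != j)%:R.

(* Points of P^1(K): [Some a] is the finite point a, [None] is infinity.      *)
Definition multiplier phi (P : option K) : K :=
  if P is Some a then reval (rderiv phi) a
  else reval (rderiv (rconj inversion phi)) 0.

End RationalMaps.

Definition rmap (K L : fieldType) (f : K -> L) (phi : {fraction {poly K}}) :
    {fraction {poly L}} :=
  tofrac (map_poly f (rnum phi))
    / tofrac (map_poly f (rden phi)).

Section Multipliers.
Variable F : closedFieldType.
Implicit Type phi : {fraction {poly F}}.

(* The fixed points of phi = A / B are the zeros of the form                  *)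
(* Y A(X, Y) - X B(X, Y) of degree deg phi + 1: the finite ones are the roots *)
(* of A - z B, and infinity has multiplicity deg phi + 1 - deg (A - z B).     *)
Definition fixed_points phi : seq (option F) :=
  let r := sval (closed_field_poly_normal (rnum phi - 'X * rden phi)) in
  map some r ++ nseq ((rdegree phi).+1 - size r) None.

Definition multipliers phi : seq F := map (multiplier phi) (fixed_points phi).

Definition sigma1 phi : F :=
  let l := multipliers phi in l`_0 + l`_1 + l`_2.
Definition sigma2 phi : F :=
  let l := multipliers phi in l`_0 * l`_1 + l`_0 * l`_2 + l`_1 * l`_2.

End Multipliers.

Definition normalized_at (L : fieldExtType rat)
    (P : prime_idealr (ring_of_integers L)) (A B : {poly L}) : Prop :=
  (forall i, p_integral P A`_i /\ p_integral P B`_i) /\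
  (exists i, p_unit P A`_i \/ p_unit P B`_i).

Definition good_reduction_at (L : fieldExtType rat)
    (P : prime_idealr (ring_of_integers L)) (psi : {fraction {poly L}}) : Prop :=
  exists A B : {poly L},
    [/\ B != 0, coprimep A B, psi = tofrac A / tofrac B,
        normalized_at P A B
      & pair_degree (map_poly (reduction P) A) (map_poly (reduction P) B)
          = rdegree psi].

Definition good_reduction (L : fieldExtType rat)
    (psi : {fraction {poly L}}) : Prop :=
  forall P : prime_idealr (ring_of_integers L),
    (exists2 x, x \in P & x != 0) -> good_reduction_at P psi.

(* [algC] is an algebraic closure of K through any embedding iota, and the    *)
(* finite extensions of K in it are the number fields L with embeddings       *)
(* K -> L -> algC composing to iota.                                          *)
Section NumberField.
Variables (K : fieldExtType rat) (iota : {rmorphism K -> algC}).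
Implicit Type phi : {fraction {poly K}}.

Definition potential_good_reduction phi : Prop :=
  exists2 M : 'M[algC]_2, M \in unitmx &
  exists (L : fieldExtType rat) (e : {rmorphism K -> L})
         (j : {rmorphism L -> algC}) (psi : {fraction {poly L}}),
    [/\ j \o e =1 iota, rmap j psi = rconj M (rmap iota phi)
      & good_reduction psi].

(* [phi] \in M_2(O_K), in the coordinates (sigma1, sigma2) on M_2.            *)
Definition integral_moduli phi : Prop :=
  exists s1 s2 : ring_of_integers K,
    iota (val s1) = sigma1 (rmap iota phi) /\
    iota (val s2) = sigma2 (rmap iota phi).

End NumberField.

(* Main.v *)
From HB Require Import structures.
Require Import Defs.
From mathcomp Require Import all_boot all_order all_algebra all_field.
From mathcomp Require Import boolp ring.
From mathcomp Require classical_sets.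

(** Write a map of degree 2 as A / B with A = n2 z^2 + n1 z + n0 and
    B = d2 z^2 + d1 z + d0, and let Res be the resultant of the two forms.

    Good reduction gives integral moduli.  The fixed points are the zeros of
    N = A - z B, and at a finite fixed point r the multiplier is
    1 + N'(r) / B(r).  Symmetrizing over the three fixed points shows that
    sigma_i = S_i / Res, where S_i is, like Res, a form of degree 4 with
    integer coefficients in the six coefficients ([sigma_qfrac]).  Conjugation
    multiplies S_1, S_2 and Res by the sixth power of the determinant, so the
    sigma_i may be computed on the conjugate psi that has good reduction.  At
    a prime P its coefficients can be taken P-integral with Res a P-unit,
    hence the sigma_i are P-integral ([good_reduction_sigma]).  An element of
    a number field that is P-integral at every nonzero P is an algebraic
    integer: otherwise its ideal of denominators would lie in some nonzero
    prime ([algint_of_p_integral]).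

    Integral moduli give potential good reduction.  The multipliers satisfy
    l1 l2 l3 = l1 + l2 + l3 - 2, so they are the roots of the polynomial
    T^3 - sigma_1 T^2 + sigma_2 T - (sigma_1 - 2), and are algebraic integers
    as soon as sigma_1 and sigma_2 are.  If there are two distinct fixed
    points, moving them to infinity and 0 gives z (z + l2) / (l1 z + 1), whose
    resultant 1 - l1 l2 need not be a unit.  The same relation between the
    multipliers reads (l1 - 1)^2 = (1 - l1 l2) (1 - l1 l3).  So if r is a
    square root of 1 - l1 l2, then r' = (l1 - 1) / r is a square root of
    1 - l1 l3, hence an algebraic integer, and conjugating by z |-> r z - l2
    turns the map into
      (z^2 + l2 r' z + l2) / (l1 z + r),
    which has algebraic integer coefficients and resultant 1.  If there is only
    one fixed point, the map is conjugate to (z^2 + 1) / z, of resultant 1 too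
    ([conjugate_integral_form]).  A map whose coefficients are integers of a
    number field and whose resultant is 1 has good reduction at all primes at
    once ([integral_good_reduction]), and one number field contains K and the
    finitely many coefficients ([number_field_extension]). *)

Set Implicit Arguments.
Unset Strict Implicit.
Unset Printing Implicit Defensive.

Import GRing.Theory Num.Theory.
Local Open Scope ring_scope.
Local Open Scope quotient_scope.

(** * Quadratic maps as coefficient vectors, and their invariants *)

(** The map [n2 X^2 + n1 XY + n0 Y^2 : d2 X^2 + d1 XY + d0 Y^2] of the
    projective line. Homogeneous coefficients spare a separate treatment of
    infinity, and turn composition into polynomial substitution. *)
Record quadmap (R : Type) :=
  QuadMap { qn2 : R; qn1 : R; qn0 : R; qd2 : R; qd1 : R; qd0 : R }.

Section QuadMapAlgebra.
Variable R : comNzRingType.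
Implicit Types (f : quadmap R) (a b c d u : R).

(** The resultant of the two quadratic forms. *)
Definition qres f :=
  let: QuadMap n2 n1 n0 d2 d1 d0 := f in
  (n2 * d0 - n0 * d2) ^+ 2 - (n2 * d1 - n1 * d2) * (n1 * d0 - n0 * d1).

(** The products of the resultant with the symmetric functions sigma_1 and
    sigma_2 of the multipliers, expanded in the coefficients; [sigma_qfrac]
    identifies them. *)
Definition qsigma1 f :=
  let: QuadMap n2 n1 n0 d2 d1 d0 := f in
  4%:R * n2 ^+ 2 * n0 * d1 + 2%:R * n2 ^+ 2 * d0 ^+ 2 - n2 * n1 ^+ 2 * d1
  - 4%:R * n2 * n1 * n0 * d2 + 4%:R * n2 * n0 * d2 * d0
  - 2%:R * n2 * n0 * d1 ^+ 2 + n1 ^+ 3 * d2 - 2%:R * n1 ^+ 2 * d2 * d0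
  + 4%:R * n1 * n0 * d2 * d1 + 4%:R * n1 * d2 * d0 ^+ 2 - n1 * d1 ^+ 2 * d0
  - 6%:R * n0 ^+ 2 * d2 ^+ 2 - 4%:R * n0 * d2 * d1 * d0 + n0 * d1 ^+ 3.

Definition qsigma2 f :=
  let: QuadMap n2 n1 n0 d2 d1 d0 := f in
  4%:R * n2 ^+ 3 * n0 - n2 ^+ 2 * n1 ^+ 2 + 2%:R * n2 ^+ 2 * n1 * d0
  - 4%:R * n2 ^+ 2 * n0 * d1 + 10%:R * n2 * n1 * n0 * d2 - n2 * n1 * d1 * d0
  - 4%:R * n2 * n0 * d2 * d0 + 5%:R * n2 * n0 * d1 ^+ 2
  + 2%:R * n2 * d1 * d0 ^+ 2 - 2%:R * n1 ^+ 3 * d2 + 5%:R * n1 ^+ 2 * d2 * d0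
  - n1 ^+ 2 * d1 ^+ 2 - 7%:R * n1 * n0 * d2 * d1 - 4%:R * n1 * d2 * d0 ^+ 2
  + 12%:R * n0 ^+ 2 * d2 ^+ 2 + 10%:R * n0 * d2 * d1 * d0
  - 2%:R * n0 * d1 ^+ 3 + 4%:R * d2 * d0 ^+ 3 - d1 ^+ 2 * d0 ^+ 2.

Definition qscale u f :=
  let: QuadMap n2 n1 n0 d2 d1 d0 := f in
  QuadMap (u * n2) (u * n1) (u * n0) (u * d2) (u * d1) (u * d0).

Definition qsubst a b c d f :=
  let: QuadMap n2 n1 n0 d2 d1 d0 := f in
  let s2 x2 x1 x0 := x2 * a ^+ 2 + x1 * a * c + x0 * c ^+ 2 in
  let s1 x2 x1 x0 :=
    2%:R * x2 * a * b + x1 * (a * d + b * c) + 2%:R * x0 * c * d in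
  let s0 x2 x1 x0 := x2 * b ^+ 2 + x1 * b * d + x0 * d ^+ 2 in
  QuadMap (s2 n2 n1 n0) (s1 n2 n1 n0) (s0 n2 n1 n0)
          (s2 d2 d1 d0) (s1 d2 d1 d0) (s0 d2 d1 d0).

Definition qpost a b c d f :=
  let: QuadMap n2 n1 n0 d2 d1 d0 := f in
  QuadMap (a * n2 + b * d2) (a * n1 + b * d1) (a * n0 + b * d0)
          (c * n2 + d * d2) (c * n1 + d * d1) (c * n0 + d * d0).

(** Conjugation by z |-> (a z + b) / (c z + d). The inverse matrix is replaced
    by the adjugate [d, -b; -c, a]: this only rescales the coefficient vector
    and keeps everything polynomial. *)
Definition qconj a b c d f := qpost d (- b) (- c) a (qsubst a b c d f).

Lemma qres_scale u f : qres (qscale u f) = u ^+ 4 * qres f.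
Proof. by case: f => *; rewrite /qres /=; ring. Qed.

Lemma qsigma1_scale u f : qsigma1 (qscale u f) = u ^+ 4 * qsigma1 f.
Proof. by case: f => *; rewrite /qsigma1 /=; ring. Qed.

Lemma qsigma2_scale u f : qsigma2 (qscale u f) = u ^+ 4 * qsigma2 f.
Proof. by case: f => *; rewrite /qsigma2 /=; ring. Qed.

Lemma qres_subst a b c d f :
  qres (qsubst a b c d f) = (a * d - b * c) ^+ 4 * qres f.
Proof. by case: f => *; rewrite /qres /=; ring. Qed.

Lemma qres_post a b c d f :
  qres (qpost a b c d f) = (a * d - b * c) ^+ 2 * qres f.
Proof. by case: f => *; rewrite /qres /=; ring. Qed.

Lemma qsigma1_conj a b c d f :
  qsigma1 (qconj a b c d f) = (a * d - b * c) ^+ 6 * qsigma1 f.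
Proof. by case: f => *; rewrite /qsigma1 /=; ring. Qed.

Lemma qsigma2_conj a b c d f :
  qsigma2 (qconj a b c d f) = (a * d - b * c) ^+ 6 * qsigma2 f.
Proof. by case: f => *; rewrite /qsigma2 /=; ring. Qed.

Lemma qconjM a b c d a' b' c' d' f :
  qconj a' b' c' d' (qconj a b c d f) =
  qconj (a * a' + b * c') (a * b' + b * d')
        (c * a' + d * c') (c * b' + d * d') f.
Proof. by case: f => *; rewrite /qconj /=; congr QuadMap; ring. Qed.

End QuadMapAlgebra.

(** * Lowest terms in a field of rational functions *)

Section RationalFunctions.
Variable F : fieldType.
Implicit Types (A B C D : {poly F}) (phi : {fraction {poly F}}).

Lemma frac_repr phi : phi = tofrac \n_(repr phi) / tofrac \d_(repr phi).
Proof.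
have e : \pi_({fraction {poly F}}) (repr phi) * tofrac \d_(repr phi)
           = tofrac \n_(repr phi).
  unlock FracField.tofrac; rewrite -[LHS]FracField.pi_mul /FracField.mulf.
  apply/eqP; rewrite FracField.equivf_def.
  by rewrite !numden_Ratio ?mulf_neq0 ?oner_eq0 ?mulr1 ?denom_ratioP // mulrC.
by rewrite -e reprK mulfK // tofrac_eq0 denom_ratioP.
Qed.

Lemma rnum_rden_lowest phi :
  [/\ rden phi != 0, coprimep (rnum phi) (rden phi)
    & phi = tofrac (rnum phi) / tofrac (rden phi)].
Proof.
rewrite /rnum /rden; set n := \n_ _; set d := \d_ _.
have d0 : d != 0 by apply: denom_ratioP.
have g0 : gcdp n d != 0 by rewrite gcdp_eq0 negb_and d0 orbT.
have nE : n = n %/ gcdp n d * gcdp n d by rewrite divpK ?dvdp_gcdl.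
have dE : d = d %/ gcdp n d * gcdp n d by rewrite divpK ?dvdp_gcdr.
have dg0 : d %/ gcdp n d != 0 by apply: contraNneq d0 => e; rewrite dE e mul0r.
split=> //; first by rewrite coprimep_div_gcd // d0 orbT.
transitivity (tofrac n / tofrac d); first exact: frac_repr.
move: g0 nE dE; set g := gcdp n d => g0 nE dE.
by rewrite [in LHS]nE [in LHS]dE !tofracM -mulf_div divff ?mulr1 ?tofrac_eq0.
Qed.

Lemma eq_lowest_terms A B C D : B != 0 -> D != 0 -> coprimep A B ->
    coprimep C D -> tofrac A / tofrac B = tofrac C / tofrac D ->
  exists2 c, c != 0 & C = c *: A /\ D = c *: B.
Proof.
move=> B0 D0 cAB cCD /eqP; rewrite eqr_div ?tofrac_eq0 // -!tofracM tofrac_eq.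
move=> /eqP e.
have BD : B %| D.
  by rewrite -(@Gauss_dvdpr _ D A) ?e ?dvdp_mull // coprimep_sym.
have DB : D %| B.
  by rewrite -(@Gauss_dvdpr _ B C) -?e ?dvdp_mull // coprimep_sym.
have /eqpP[[u v] /= /andP[u0 v0] uv] : B %= D by rewrite /eqp BD DB.
have DE : D = (u / v) *: B.
  by rewrite mulrC -scalerA uv scalerA mulVf ?scale1r.
exists (u / v); first by rewrite mulf_neq0 ?invr_eq0.
split=> //; apply: (mulIf B0).
by rewrite -e DE -scalerAl scalerAr.
Qed.

(** The numerator and denominator attached to a fraction depend on a chosen
    representative. This lemma and its consequences below replace them by any
    given pair in lowest terms, up to one common scalar. *)
Lemma rnum_rdenP A B : B != 0 -> coprimep A B ->
  exists2 c, c != 0 &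
    rnum (tofrac A / tofrac B) = c *: A /\ rden (tofrac A / tofrac B) = c *: B.
Proof.
move=> B0 cAB; have [D0 cCD e] := rnum_rden_lowest (tofrac A / tofrac B).
exact: eq_lowest_terms.
Qed.

Lemma pair_degree_coprime A B : coprimep A B ->
  pair_degree A B = (maxn (size A) (size B)).-1.
Proof.
rewrite coprimep_def => /eqP s1; rewrite /pair_degree.
have g0 : gcdp A B != 0 by rewrite -size_poly_eq0 s1.
by rewrite !size_divp // s1 !subn0.
Qed.

Lemma rdegreeE phi :
  rdegree phi = (maxn (size (rnum phi)) (size (rden phi))).-1.
Proof. by have [_ c _] := rnum_rden_lowest phi; apply: pair_degree_coprime. Qed.

(** Cancelling a nonconstant common factor lowers the degree, so the maximal
    possible degree is attained only by coprime pairs. *)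
Lemma pair_degree_full A B n : (size A <= n.+2)%N -> (size B <= n.+2)%N ->
  pair_degree A B = n.+1 -> coprimep A B /\ maxn (size A) (size B) = n.+2.
Proof.
move=> sA sB; rewrite /pair_degree.
have [g0|g0] := eqVneq (gcdp A B) 0.
  by rewrite g0 !divp0 size_poly0.
rewrite coprimep_def !size_divp //.
have gs : (0 < size (gcdp A B))%N by rewrite size_poly_gt0.
case: (size (gcdp A B)) gs => // -[|k] _ /=; last first.
  move=> e; exfalso; suff: (maxn (size A - k.+1) (size B - k.+1) <= n.+1)%N.
    by case: (maxn _ _) e => //= m ->; rewrite ltnn.
  by rewrite geq_max !leq_subLR addSnnS; apply/andP; split;
    apply: leq_trans (leq_addl _ _).
rewrite !subn0 => e; split=> //; case: (maxn _ _) e => //= m -> //.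
Qed.

Lemma peval_is_horner phi A : 
  peval A phi = (map_poly ((@tofrac {poly F}) \o polyC) A).[phi].
Proof. by []. Qed.

Lemma pevalZ c A phi : peval (c *: A) phi = tofrac c%:P * peval A phi.
Proof. by rewrite !peval_is_horner map_polyZ hornerZ. Qed.

Lemma rcomp_lowest A B phi : B != 0 -> coprimep A B ->
  rcomp (tofrac A / tofrac B) phi = peval A phi / peval B phi.
Proof.
move=> B0 cAB; have [c c0 [nE dE]] := rnum_rdenP B0 cAB.
rewrite /rcomp nE dE !pevalZ -mulf_div divff ?mul1r //.
by rewrite tofrac_eq0 polyC_eq0.
Qed.

(** In lowest terms the denominator divides every other denominator of the
    same function, so it cannot vanish at x either. *)
Lemma reval_lowest A B x : B.[x] != 0 ->
  reval (tofrac A / tofrac B) x = A.[x] / B.[x].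
Proof.
move=> Bx; have [D0 cCD e] := rnum_rden_lowest (tofrac A / tofrac B).
set C := rnum _ in cCD e; set D := rden _ in D0 cCD e.
have B0 : B != 0 by apply: contraNneq Bx => ->; rewrite horner0.
move/eqP: e; rewrite eqr_div ?tofrac_eq0 // -!tofracM tofrac_eq => /eqP e.
have ex : A.[x] * D.[x] = C.[x] * B.[x] by rewrite -!hornerM e.
have Dx : D.[x] != 0.
  apply/negP => /[dup] /eqP Dx0 Dx; move: ex; rewrite Dx0 mulr0 => /esym/eqP.
  rewrite mulf_eq0 (negPf Bx) orbF; apply/negP.
  by apply: coprimep_root Dx; rewrite coprimep_sym.
by rewrite /reval -/C -/D; apply/eqP; rewrite eqr_div // -ex.
Qed.

End RationalFunctions.

Section MapRational.
Variables (K L : fieldType) (e : {rmorphism K -> L}).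

Lemma rmap_lowest (A B : {poly K}) : B != 0 -> coprimep A B ->
  rmap e (tofrac A / tofrac B)
    = tofrac (map_poly e A) / tofrac (map_poly e B).
Proof.
move=> B0 cAB; have [c c0 [nE dE]] := rnum_rdenP B0 cAB.
rewrite /rmap nE dE !linearZ /= -!mul_polyC !tofracM -mulf_div divff ?mul1r //.
by rewrite tofrac_eq0 polyC_eq0 fmorph_eq0.
Qed.

Lemma rdegree_map phi : rdegree (rmap e phi) = rdegree phi.
Proof.
have [D0 cCD _] := rnum_rden_lowest phi.
rewrite /rmap; set A := map_poly _ _; set B := map_poly _ _.
have B0 : B != 0 by rewrite map_poly_eq0.
have cAB : coprimep A B by rewrite coprimep_map.
have [c c0 [nE dE]] := rnum_rdenP B0 cAB.
by rewrite !rdegreeE nE dE !size_scale // !size_map_poly.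
Qed.

End MapRational.

(** * Degree 2 rational functions and their conjugates *)

Section Quadratic.
Variable R : nzRingType.
Definition quadratic (x2 x1 x0 : R) : {poly R} :=
  x2%:P * 'X^2 + x1%:P * 'X + x0%:P.

Lemma coef_quadratic x2 x1 x0 i :
  (quadratic x2 x1 x0)`_i = [:: x0; x1; x2]`_i.
Proof.
rewrite /quadratic !coefD !coefCM coefXn coefX coefC.
by case: i => [|[|[|i]]] /=; rewrite ?(mulr0, mulr1, add0r, addr0) // nth_nil.
Qed.

Lemma size_quadratic x2 x1 x0 : (size (quadratic x2 x1 x0) <= 3)%N.
Proof.
by apply/leq_sizeP => -[|[|[|i]]] // _; rewrite coef_quadratic /= nth_nil.
Qed.

Lemma quadratic_coef (A : {poly R}) : (size A <= 3)%N ->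
  A = quadratic A`_2 A`_1 A`_0.
Proof.
move=> /leq_sizeP sA; apply/polyP => -[|[|[|i]]]; rewrite coef_quadratic //=.
by rewrite nth_nil sA.
Qed.

Lemma size_quadratic_eq3 x2 x1 x0 :
  (size (quadratic x2 x1 x0) == 3) = (x2 != 0).
Proof.
have s := size_quadratic x2 x1 x0.
have c2 : (quadratic x2 x1 x0)`_2 = x2 by rewrite coef_quadratic.
apply/eqP/idP => [e|x20].
  by move: (lead_coef_eq0 (quadratic x2 x1 x0));
    rewrite lead_coefE -size_poly_eq0 e /= c2 => ->.
apply/eqP; rewrite eqn_leq s ltnNge; apply: contraNN x20 => /leq_sizeP/(_ 2%N).
by rewrite c2 => ->.
Qed.
End Quadratic.

Lemma map_quadratic (R S : nzRingType) (e : {rmorphism R -> S}) x2 x1 x0 :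
  map_poly e (quadratic x2 x1 x0) = quadratic (e x2) (e x1) (e x0).
Proof.
apply/polyP => -[|[|[|i]]]; rewrite coef_map !coef_quadratic //=.
by rewrite !nth_nil rmorph0.
Qed.

Lemma horner_quadratic (R : comNzRingType) (x2 x1 x0 x : R) :
  (quadratic x2 x1 x0).[x] = x2 * x ^+ 2 + x1 * x + x0.
Proof. by rewrite /quadratic !hornerE. Qed.

Definition qmap (R S : Type) (e : R -> S) (f : quadmap R) : quadmap S :=
  let: QuadMap n2 n1 n0 d2 d1 d0 := f in
  QuadMap (e n2) (e n1) (e n0) (e d2) (e d1) (e d0).

Lemma qres_map (R S : comNzRingType) (e : {rmorphism R -> S}) f :
  qres (qmap e f) = e (qres f).
Proof. by case: f => * /=; rewrite !(rmorphB, rmorphXn, rmorphM). Qed.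

Lemma qsigma1_map (R S : comNzRingType) (e : {rmorphism R -> S}) f :
  qsigma1 (qmap e f) = e (qsigma1 f).
Proof. by case: f => * /=; ring. Qed.

Lemma qsigma2_map (R S : comNzRingType) (e : {rmorphism R -> S}) f :
  qsigma2 (qmap e f) = e (qsigma2 f).
Proof. by case: f => * /=; ring. Qed.

Section QuadraticRationalMaps.
Variable F : fieldType.
Implicit Types (f g : quadmap F) (A B : {poly F}) (phi : {fraction {poly F}}).

Definition qnum f := quadratic (qn2 f) (qn1 f) (qn0 f).
Definition qden f := quadratic (qd2 f) (qd1 f) (qd0 f).
Definition qfrac f : {fraction {poly F}} := tofrac (qnum f) / tofrac (qden f).

Definition quadmap_of A B : quadmap F := QuadMap A`_2 A`_1 A`_0 B`_2 B`_1 B`_0.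

Lemma qnum_of A B : (size A <= 3)%N -> qnum (quadmap_of A B) = A.
Proof. by move=> sA; rewrite [RHS]quadratic_coef. Qed.

Lemma qden_of A B : (size B <= 3)%N -> qden (quadmap_of A B) = B.
Proof. by move=> sB; rewrite [RHS]quadratic_coef. Qed.

(** Eliminating X^2 between A and B leaves the linear form p X + q; a second
    elimination, with r = n1 d0 - n0 d1, leaves the constant q^2 - p r, which
    is the resultant. The cofactors of A and B have degree at most 1, which
    [coprime_qres] uses. *)
Lemma qres_bezout f :
  let q := (qn2 f * qd0 f - qn0 f * qd2 f)%:P in
  let p := (qn2 f * qd1 f - qn1 f * qd2 f)%:P in
  ((p * 'X - q) * (qd2 f)%:P + p * (qd1 f)%:P) * qnum f
  - ((p * 'X - q) * (qn2 f)%:P + p * (qn1 f)%:P) * qden f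
  = (qres f)%:P.
Proof.
by case: f => n2 n1 n0 d2 d1 d0; rewrite /qnum /qden /quadratic /=; ring.
Qed.

Lemma qres_coprime f : qres f != 0 -> coprimep (qnum f) (qden f).
Proof.
move=> r0; have /= e := qres_bezout f.
apply/coprimepP => d dA dB.
have : d %| (qres f)%:P by rewrite -e dvdp_sub ?dvdp_mull.
by rewrite -alg_polyC dvdpZr // dvdp1 size_poly_eq1.
Qed.

Lemma qres_lead f : qres f != 0 -> (qn2 f != 0) || (qd2 f != 0).
Proof.
rewrite -negb_and; apply: contra_neqN => /andP[/eqP + /eqP].
by case: f => n2 n1 n0 d2 d1 d0 /= -> ->; ring.
Qed.

Lemma max_size_quadmap f :
  (maxn (size (qnum f)) (size (qden f)) == 3) = (qn2 f != 0) || (qd2 f != 0).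
Proof.
rewrite -(size_quadratic_eq3 (qn2 f) (qn1 f) (qn0 f)).
rewrite -(size_quadratic_eq3 (qd2 f) (qd1 f) (qd0 f)) -/(qnum f) -/(qden f).
have := size_quadratic (qn2 f) (qn1 f) (qn0 f).
have := size_quadratic (qd2 f) (qd1 f) (qd0 f).
rewrite -/(qnum f) -/(qden f); move: (size _) (size _) => m n.
by do 4?[case: m => [|m] //]; do 4?[case: n => [|n] //].
Qed.

Definition qswap f :=
  QuadMap (qd2 f) (qd1 f) (qd0 f) (qn2 f) (qn1 f) (qn0 f).

(** If the resultant vanishes, the Bezout identity becomes u A = v B with v of
    degree at most 1. As A is coprime to B it divides v, so v = 0 because A
    has degree 2; the coefficients of v then make A and B proportional. *)
Lemma coprime_qres f :
  coprimep (qnum f) (qden f) -> qn2 f != 0 -> qres f != 0.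
Proof.
move=> c n20; apply/eqP => r0.
have sA : size (qnum f) = 3%N.
  by apply/eqP; rewrite size_quadratic_eq3.
have /= e := qres_bezout f; move: e; rewrite r0 => /subr0_eq.
set p := qn2 f * qd1 f - _; set q := qn2 f * qd0 f - _.
set v := (_ + p%:P * (qn1 f)%:P) => e.
have vE : v = quadratic 0 (p * qn2 f) (p * qn1 f - q * qn2 f).
  by rewrite /v /quadratic; ring.
have v0 : v = 0.
  apply/eqP/negPn/negP => v0.
  have dv : qnum f %| v.
    by rewrite -(@Gauss_dvdpl _ _ (qden f)) // -e dvdp_mull.
  have := dvdp_leq v0 dv; rewrite sA vE => s3.
  have := size_quadratic_eq3 0 (p * qn2 f) (p * qn1 f - q * qn2 f).
  by rewrite eqxx eqn_leq s3 size_quadratic.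
have p0 : p = 0.
  have := congr1 (fun P : {poly F} => P`_1) v0.
  rewrite vE coef_quadratic coef0 /= => /eqP.
  by rewrite mulf_eq0 (negPf n20) orbF => /eqP.
have q0 : q = 0.
  have := congr1 (fun P : {poly F} => P`_0) v0.
  rewrite vE coef_quadratic coef0 /= p0 mul0r sub0r => /eqP.
  by rewrite oppr_eq0 mulf_eq0 (negPf n20) orbF => /eqP.
have par : qn2 f *: qden f = qd2 f *: qnum f.
  apply/eqP; rewrite -subr_eq0 -!mul_polyC.
  suff -> : (qn2 f)%:P * qden f - (qd2 f)%:P * qnum f = p%:P * 'X + q%:P.
    by rewrite p0 q0 mul0r addr0.
  by rewrite /p /q /qden /qnum /quadratic; ring.
have dA : qnum f %| qden f.
  by rewrite -(dvdpZr _ _ n20) par -mul_polyC dvdp_mull.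
by move: c; rewrite coprimep_def (eqp_size (dvdp_gcd_idl dA)) sA.
Qed.

Lemma pair_degree_quadmap f :
  pair_degree (qnum f) (qden f) = 2%N <-> qres f != 0.
Proof.
split=> [e|r0]; last first.
  rewrite pair_degree_coprime ?qres_coprime //.
  by have := qres_lead r0; rewrite -max_size_quadmap => /eqP ->.
have [c /eqP] :=
  pair_degree_full (size_quadratic _ _ _) (size_quadratic _ _ _) e.
rewrite max_size_quadmap => /orP[|d20]; first exact: coprime_qres.
have r : qres f = qres (qswap f) by case: (f) => *; rewrite /qres /=; ring.
by rewrite r coprime_qres // coprimep_sym.
Qed.

Lemma qden_neq0 f : qres f != 0 -> qden f != 0.
Proof.
apply: contra_neq => e.
have d2 : qd2 f = 0.
  by rewrite -[LHS](coef_quadratic _ (qd1 f) (qd0 f) 2) -/(qden f) e coef0.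
have d1 : qd1 f = 0.
  by rewrite -[LHS](coef_quadratic (qd2 f) _ (qd0 f) 1) -/(qden f) e coef0.
have d0 : qd0 f = 0.
  by rewrite -[LHS](coef_quadratic (qd2 f) (qd1 f) _ 0) -/(qden f) e coef0.
by move: d2 d1 d0; case: (f) => *; simpl in *; subst; ring.
Qed.

Lemma rdegree2_quadmap phi : rdegree phi = 2%N ->
  exists f,
    [/\ phi = qfrac f, rnum phi = qnum f, rden phi = qden f & qres f != 0].
Proof.
move=> deg; have [D0 c e] := rnum_rden_lowest phi.
have : maxn (size (rnum phi)) (size (rden phi)) = 3%N.
  by move: deg; rewrite rdegreeE; case: (maxn _ _) => // n /= ->.
move=> mx; have sA : (size (rnum phi) <= 3)%N by rewrite -mx leq_maxl.
have sB : (size (rden phi) <= 3)%N by rewrite -mx leq_maxr.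
exists (quadmap_of (rnum phi) (rden phi)); rewrite /qfrac qnum_of // qden_of //.
split=> //; apply/pair_degree_quadmap.
by rewrite qnum_of // qden_of // pair_degree_coprime // mx.
Qed.

Lemma rnum_rden_qfrac f : qres f != 0 ->
  exists2 c, c != 0 &
    rnum (qfrac f) = c *: qnum f /\ rden (qfrac f) = c *: qden f.
Proof.
by move=> r; apply: rnum_rdenP; [apply: qden_neq0|apply: qres_coprime].
Qed.

Lemma rdegree_qfrac f : qres f != 0 -> rdegree (qfrac f) = 2%N.
Proof.
move=> r; have [c c0 [nE dE]] := rnum_rden_qfrac r.
rewrite rdegreeE nE dE !size_scale //.
by have := qres_lead r; rewrite -max_size_quadmap => /eqP ->.
Qed.

Lemma qfrac_inj f g : qres f != 0 -> qres g != 0 -> qfrac f = qfrac g ->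
  exists2 c, c != 0 & g = qscale c f.
Proof.
move=> rf rg /eq_lowest_terms[|||| c c0 [nE dE]];
  rewrite ?qden_neq0 ?qres_coprime //.
exists c => //.
have coefE p2 p1 p0 u2 u1 u0 : quadratic p2 p1 p0 = c *: quadratic u2 u1 u0 ->
    [/\ p2 = c * u2, p1 = c * u1 & p0 = c * u0] :> Prop.
  move=> e; have ei i := congr1 (fun P : {poly F} => P`_i) e.
  by move: (ei 0%N) (ei 1%N) (ei 2%N); rewrite !coefZ !coef_quadratic.
have [] := coefE _ _ _ _ _ _ nE; have [] := coefE _ _ _ _ _ _ dE.
by case: (f) (g) => /= ? ? ? ? ? ? [] /= ? ? ? ? ? ? -> -> -> -> -> ->.
Qed.

Lemma qfrac_scale c f : c != 0 -> qfrac (qscale c f) = qfrac f.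
Proof.
move=> c0; rewrite /qfrac.
have qE x2 x1 x0 : quadratic (c * x2) (c * x1) (c * x0)
    = c%:P * quadratic x2 x1 x0 by rewrite /quadratic !polyCM; ring.
case: (f) => n2 n1 n0 d2 d1 d0; rewrite /qnum /qden /= !qE !tofracM -mulf_div.
by rewrite divff ?mul1r // tofrac_eq0 polyC_eq0.
Qed.

(** Stated for an abstract morphism so that the field computation does not
    look inside the fraction field. *)
Lemma quadratic_form_ratio (R : comNzRingType) (E : fieldType)
    (g : {rmorphism R -> E}) (x2 x1 x0 a b : R) : g b != 0 ->
  g x2 * (g a / g b) ^+ 2 + g x1 * (g a / g b) + g x0
    = g (x2 * a ^+ 2 + x1 * a * b + x0 * b ^+ 2) / g (b ^+ 2).
Proof. by move=> b0; field. Qed.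

Lemma peval_quadratic x2 x1 x0 (A B : {poly F}) : B != 0 ->
  peval (quadratic x2 x1 x0) (tofrac A / tofrac B)
    = tofrac (x2%:P * A ^+ 2 + x1%:P * A * B + x0%:P * B ^+ 2)
      / tofrac (B ^+ 2).
Proof.
move=> B0; rewrite peval_is_horner map_quadratic horner_quadratic /=.
have := @quadratic_form_ratio _ _ (@tofrac {poly F}) x2%:P x1%:P x0%:P A B.
by rewrite tofrac_eq0 => /(_ B0) <-.
Qed.

Lemma det_mx22 (R : comNzRingType) (M : 'M[R]_2) :
  \det M = M 0 0 * M 1 1 - M 0 1 * M 1 0.
Proof.
rewrite (expand_det_row _ 0) !big_ord_recl big_ord0 /cofactor !det_mx11 !mxE /=.
rewrite !expr0 !expr1 mul1r mulN1r mulrN addr0.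
by congr (M _ _ * M _ _ - M _ _ * M _ _); apply: val_inj.
Qed.

Lemma invmx2 (M : 'M[F]_2) : M \in unitmx ->
  let D := M 0 0 * M 1 1 - M 0 1 * M 1 0 in
  [/\ D != 0, invmx M 0 0 = D^-1 * M 1 1, invmx M 0 1 = D^-1 * - M 0 1,
     invmx M 1 0 = D^-1 * - M 1 0 & invmx M 1 1 = D^-1 * M 0 0].
Proof.
move=> uM D; have DE : D = \det M by rewrite det_mx22.
have D0 : D != 0 by rewrite DE -unitfE -unitmxE.
pose N : 'M[F]_2 := \matrix_(i, j) (D^-1 *
  (if i == 0 then if j == 0 then M 1 1 else - M 0 1
    else if j == 0 then - M 1 0 else M 0 0)).
have NM : N *m M = 1%:M.
  have ord2 (i : 'I_2) : i = 0 \/ i = 1.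
    by case: i => [[|[|//]] p]; [left|right]; apply: val_inj.
  apply/matrixP => i j; rewrite mxE !big_ord_recl big_ord0 !mxE /=.
  have -> : lift ord0 ord0 = 1 :> 'I_2 by apply: val_inj.
  have -> : ord0 = 0 :> 'I_2 by [].
  by case: (ord2 i) => ->; case: (ord2 j) => -> /=; rewrite /D in D0 *; field.
have -> : invmx M = N by rewrite -[LHS]mul1mx -NM mulmxK.
by rewrite !mxE.
Qed.

Lemma peval_linear x1 x0 (A B : {poly F}) : B != 0 ->
  peval (x1 *: 'X + x0%:P) (tofrac A / tofrac B)
    = tofrac (x1%:P * A + x0%:P * B) / tofrac B.
Proof.
move=> B0; rewrite peval_is_horner rmorphD /= map_polyZ map_polyX map_polyC.
rewrite !hornerE /= tofracD !tofracM mulrDl ?mulrA; congr (_ + _).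
by rewrite mulfK // tofrac_eq0.
Qed.

Lemma mobius_lowest (a b c d : F) : a * d - b * c != 0 ->
  c *: 'X + d%:P != 0 /\ coprimep (a *: 'X + b%:P) (c *: 'X + d%:P).
Proof.
move=> D0; split.
  apply: contra_neq D0 => e.
  have ei i : (c *: 'X + d%:P)`_i = 0 by rewrite e coef0.
  move: (ei 0%N) (ei 1%N); rewrite !coefD !coefZ !coefC !coefX /=.
  by rewrite mulr0 mulr1 add0r addr0 => -> ->; rewrite !mulr0 subr0.
apply/coprimepP => p pA pB.
have : p %| (a * d - b * c)%:P.
  have -> : (a * d - b * c)%:P =
      a%:P * (c *: 'X + d%:P) - c%:P * (a *: 'X + b%:P).
    by rewrite -!mul_polyC; ring.
  by rewrite dvdp_sub ?dvdp_mull.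
by rewrite -alg_polyC dvdpZr // dvdp1 size_poly_eq1.
Qed.

Definition mxconj (M : 'M[F]_2) := qconj (M 0 0) (M 0 1) (M 1 0) (M 1 1).

(** The exponent 6 is 4 for the substitution into two quadratic forms plus 2
    for the recombination of the results. The numerators of sigma_1 and
    sigma_2 carry the same exponent, which makes the quotients invariant. *)
Lemma qres_conj a b c d f :
  qres (qconj a b c d f) = (a * d - b * c) ^+ 6 * qres f.
Proof. by rewrite qres_post qres_subst; ring. Qed.

Lemma rconj_qfrac (M : 'M[F]_2) f : M \in unitmx -> qres f != 0 ->
  rconj M (qfrac f) = qfrac (mxconj M f).
Proof.
move=> uM rf; have [D0 e00 e01 e10 e11] := invmx2 uM.
rewrite /rconj /mxconj {2}/mobius.
set a := M 0 0 in D0 e00 e01 e10 e11 *; set b := M 0 1 in D0 e00 e01 e10 e11 *.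
set c := M 1 0 in D0 e00 e01 e10 e11 *; set d := M 1 1 in D0 e00 e01 e10 e11 *.
set D := a * d - b * c in D0 e00 e01 e10 e11.
have [q0 _] := mobius_lowest D0.
rewrite /qfrac rcomp_lowest ?qden_neq0 ?qres_coprime // !peval_quadratic //.
have rs : qres (qsubst a b c d f) != 0.
  by rewrite qres_subst mulf_neq0 ?expf_neq0.
have Q0 := qden_neq0 rs.
set G := qsubst a b c d f in rs Q0 *.
have -> : tofrac ((qn2 f)%:P * (a *: 'X + b%:P) ^+ 2 +
     (qn1 f)%:P * (a *: 'X + b%:P) * (c *: 'X + d%:P)
     + (qn0 f)%:P * (c *: 'X + d%:P) ^+ 2) = tofrac (qnum G).
  congr tofrac; rewrite /G /qnum; case: (f) => *; rewrite /= /quadratic.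
  by rewrite -!mul_polyC; ring.
have -> : tofrac ((qd2 f)%:P * (a *: 'X + b%:P) ^+ 2 +
     (qd1 f)%:P * (a *: 'X + b%:P) * (c *: 'X + d%:P)
     + (qd0 f)%:P * (c *: 'X + d%:P) ^+ 2) = tofrac (qden G).
  congr tofrac; rewrite /G /qden; case: (f) => *; rewrite /= /quadratic.
  by rewrite -!mul_polyC; ring.
have -> : tofrac (qnum G) / tofrac ((c *: 'X + d%:P) ^+ 2)
    / (tofrac (qden G) / tofrac ((c *: 'X + d%:P) ^+ 2))
    = tofrac (qnum G) / tofrac (qden G).
  rewrite invf_div mulf_div [X in _ / X]mulrC -mulf_div divff ?mulr1 //.
  by rewrite tofrac_eq0 expf_neq0.
rewrite /mobius e00 e01 e10 e11.
have Di0 : D^-1 != 0 by rewrite invr_eq0.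
have iD : (D^-1 * d) * (D^-1 * a) - (D^-1 * - b) * (D^-1 * - c) != 0.
  have -> : (D^-1 * d) * (D^-1 * a) - (D^-1 * - b) * (D^-1 * - c) = D^-1.
    by rewrite -[RHS]mulr1 -[in RHS](mulVf D0) /D; ring.
  by [].
have [q1 c1] := mobius_lowest iD.
rewrite rcomp_lowest // !peval_linear //.
rewrite invf_div mulf_div [X in _ / X]mulrC -mulf_div divff ?mulr1 ?tofrac_eq0 //.
have nE : (D^-1 * d)%:P * qnum G + (D^-1 * - b)%:P * qden G
   = qnum (qscale D^-1 (qconj a b c d f)).
  rewrite /qconj -/G /qnum /qden; case: (G) => *; rewrite /= /quadratic; ring.
have dE : (D^-1 * - c)%:P * qnum G + (D^-1 * a)%:P * qden G
   = qden (qscale D^-1 (qconj a b c d f)).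
  rewrite /qconj -/G /qnum /qden; case: (G) => *; rewrite /= /quadratic; ring.
by rewrite nE dE -[RHS](qfrac_scale _ Di0).
Qed.

Lemma mxconj_neq0 (M : 'M[F]_2) f : M \in unitmx -> qres f != 0 ->
  qres (mxconj M f) != 0.
Proof.
move=> uM rf; have [D0 _ _ _ _] := invmx2 uM.
by rewrite qres_conj mulf_neq0 ?expf_neq0.
Qed.

(** The coordinates sigma_1 and sigma_2 on the moduli space. *)
Definition qinv1 f : F := qsigma1 f / qres f.
Definition qinv2 f : F := qsigma2 f / qres f.

Lemma divMM (u x y : F) : u != 0 -> (u * x) / (u * y) = x / y.
Proof. by move=> u0; rewrite -mulf_div divff ?mul1r. Qed.

Lemma qinv_scale u f : u != 0 ->
  qinv1 (qscale u f) = qinv1 f /\ qinv2 (qscale u f) = qinv2 f.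
Proof.
move=> u0; rewrite /qinv1 /qinv2 qres_scale qsigma1_scale qsigma2_scale.
by rewrite !divMM ?expf_neq0.
Qed.

Lemma qinv_conj (M : 'M[F]_2) f : M \in unitmx ->
  qinv1 (mxconj M f) = qinv1 f /\ qinv2 (mxconj M f) = qinv2 f.
Proof.
move=> uM; have [D0 _ _ _ _] := invmx2 uM.
rewrite /qinv1 /qinv2 qres_conj qsigma1_conj qsigma2_conj.
by rewrite !divMM ?expf_neq0.
Qed.

End QuadraticRationalMaps.

Lemma qinv1_map (K L : fieldType) (e : {rmorphism K -> L}) f :
  qinv1 (qmap e f) = e (qinv1 f).
Proof. by rewrite /qinv1 qres_map qsigma1_map fmorph_div. Qed.

Lemma qinv2_map (K L : fieldType) (e : {rmorphism K -> L}) f :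
  qinv2 (qmap e f) = e (qinv2 f).
Proof. by rewrite /qinv2 qres_map qsigma2_map fmorph_div. Qed.

Lemma rmap_qfrac (K L : fieldType) (e : {rmorphism K -> L}) f : qres f != 0 ->
  rmap e (qfrac f) = qfrac (qmap e f).
Proof.
move=> rf; rewrite rmap_lowest ?qden_neq0 ?qres_coprime //.
by rewrite !map_quadratic; case: f {rf}.
Qed.

(** * The symmetric functions of the multipliers *)

Section Multipliers.
Variable F : closedFieldType.
Implicit Types (f g : quadmap F) (x : F).

Lemma deriv_quadratic (x2 x1 x0 x : F) :
  (quadratic x2 x1 x0)^`().[x] = 2%:R * x2 * x + x1.
Proof. by rewrite /quadratic !derivE !hornerE; ring. Qed.

(** At a finite fixed point this value is the multiplier. *)
Lemma reval_rderiv f x : qres f != 0 -> (qden f).[x] != 0 ->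
  reval (rderiv (qfrac f)) x
    = ((2%:R * qn2 f * x + qn1 f) * (qden f).[x]
        - (qnum f).[x] * (2%:R * qd2 f * x + qd1 f)) / (qden f).[x] ^+ 2.
Proof.
move=> rf dx; have [c c0 [nE dE]] := rnum_rden_qfrac rf.
rewrite /rderiv nE dE reval_lowest; last first.
  by rewrite horner_exp expf_neq0 // hornerZ mulf_neq0.
rewrite !derivZ horner_exp hornerD hornerN !hornerM !hornerZ !deriv_quadratic.
by field; rewrite c0 dx.
Qed.

Lemma multiplier_inf f : qres f != 0 -> qd2 f = 0 ->
  multiplier (qfrac f) None = qd1 f / qn2 f.
Proof.
move=> rf d2; have := qres_lead rf; rewrite d2 eqxx orbF => n2.
have uI : inversion F \in unitmx.
  by rewrite unitmxE det_mx22 !mxE /= mulr0 sub0r mulr1 unitrN unitr1.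
rewrite /multiplier rconj_qfrac // reval_rderiv ?mxconj_neq0 //.
all: rewrite /mxconj !mxE /= /qden /qnum !horner_quadratic.
all: case: (f) d2 n2 => /= n2 n1 n0 d2 d1 d0 -> n20.
  by field; rewrite n20 oppr_eq0 oner_eq0.
by rewrite [X in X != 0](_ : _ = - n2) ?oppr_eq0 //; ring.
Qed.

(** The finite fixed points are the roots of A - z B, and infinity accounts for
    the rest of the three. *)
Lemma multipliers_qfrac f : qres f != 0 -> 
  exists (c : F) (r : seq F), [/\ c != 0, (size r <= 3)%N,
     qnum f - 'X * qden f = c *: \prod_(z <- r) ('X - z%:P)
   & multipliers (qfrac f) = map (multiplier (qfrac f)) (map some r)
       ++ nseq (3 - size r) (multiplier (qfrac f) None)].
Proof.
move=> rf; rewrite /multipliers /fixed_points rdegree_qfrac //.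
case: closed_field_poly_normal => r /=.
have [c c0 [-> ->]] := rnum_rden_qfrac rf.
rewrite -scalerAr -scalerBr => e.
have lE : qnum f - 'X * qden f =
    lead_coef (qnum f - 'X * qden f) *: \prod_(z <- r) ('X - z%:P).
  by apply: (scalerI c0); rewrite e lead_coefZ scalerA.
exists (lead_coef (qnum f - 'X * qden f)), r.
have N0 : qnum f - 'X * qden f != 0.
  apply: contra_neq rf => N0.
  have ei i : (qnum f - 'X * qden f)`_i = 0 by rewrite N0 coef0.
  move: (ei 0%N) (ei 1%N) (ei 2%N) (ei 3%N).
  rewrite !coefB !coefXM !coef_quadratic /=.
  case: (f) => /= n2 n1 n0 d2 d1 d0.
  rewrite subr0 sub0r => -> /subr0_eq -> /subr0_eq -> /eqP.
  by rewrite oppr_eq0 => /eqP ->; ring.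
split=> //; first by rewrite lead_coef_eq0.
- have : (size (qnum f - 'X * qden f)%R <= 4)%N.
    apply/leq_sizeP => -[|[|[|[|i]]]] // _.
    by rewrite coefB coefXM !coef_quadratic /= !nth_nil subr0.
  by rewrite lE size_scale ?lead_coef_eq0 // size_prod_XsubC.
- by rewrite map_cat map_nseq.
Qed.

(** A common zero of A - z B and B would be a zero of A as well. *)
Lemma qden_fixed f x : qres f != 0 -> (qnum f - 'X * qden f).[x] = 0 ->
  (qden f).[x] != 0.
Proof.
move=> rf; rewrite hornerD hornerN hornerM hornerX => /subr0_eq e.
apply/eqP => d0; move: e; rewrite d0 mulr0 => /eqP /(coprimep_root (qres_coprime rf)).
by rewrite d0 eqxx.
Qed.

Lemma coef_cubic f i :
  (qnum f - 'X * qden f)`_i =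
  [:: qn0 f; qn1 f - qd0 f; qn2 f - qd1 f; - qd2 f]`_i.
Proof.
rewrite coefB coefXM !coef_quadratic.
by case: i => [|[|[|[|i]]]] /=; rewrite ?subr0 ?sub0r ?nth_nil ?oppr0.
Qed.

Lemma coef_X_quadratic (x3 x2 x1 x0 : F) i :
  ('X * quadratic x3 x2 x1 + x0%:P)`_i = [:: x0; x1; x2; x3]`_i.
Proof.
rewrite coefD coefXM coef_quadratic coefC.
by case: i => [|[|[|[|i]]]] /=; rewrite ?addr0 ?add0r ?nth_nil.
Qed.

Lemma cubic_coefs f x3 x2 x1 x0 :
    qnum f - 'X * qden f = 'X * quadratic x3 x2 x1 + x0%:P ->
  [/\ qn0 f = x0, qn1 f = x1 + qd0 f, qn2 f = x2 + qd1 f & qd2 f = - x3].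
Proof.
move=> e; have ei i := coef_cubic f i.
move: (ei 0%N) (ei 1%N) (ei 2%N) (ei 3%N); rewrite !e !coef_X_quadratic /=.
by move=> -> -> -> ->; rewrite !subrK opprK.
Qed.

(** The factorization A - z B = c (z - r_1) ... (z - r_k), with k at most 3,
    expresses n2, n1, n0 and d2 as polynomials in c, the roots and d1, d0, so
    that for each k the claim is an identity between rational functions. The
    missing 3 - k fixed points are at infinity, where d2 = 0 and the
    multiplier is d1 / n2. *)
Lemma sigma_qfrac f : qres f != 0 ->
  sigma1 (qfrac f) = qinv1 f /\ sigma2 (qfrac f) = qinv2 f.
Proof.
move=> rf; have [c [r [c0 sr NE mE]]] := multipliers_qfrac rf.
rewrite /sigma1 /sigma2 /qinv1 /qinv2 mE {mE}.
(* Generalizing the multipliers keeps simplification from unfolding them. *)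
have mS x : (qden f).[x] != 0 -> multiplier (qfrac f) (Some x)
    = ((2%:R * qn2 f * x + qn1 f) * (qden f).[x]
        - (qnum f).[x] * (2%:R * qd2 f * x + qd1 f)) / (qden f).[x] ^+ 2.
  exact: reval_rderiv.
have := multiplier_inf rf; move: (multiplier _) mS => m mS mI.
have dn x : x \in r -> (qden f).[x] != 0.
  move=> xr; apply: qden_fixed => //; rewrite NE hornerZ.
  have /rootP -> : root (\prod_(z <- r) ('X - z%:P)) x.
    by rewrite root_prod_XsubC.
  by rewrite mulr0.
case: r sr NE dn => [|x [|y [|z [|//]]]] _ + dn;
  rewrite ?big_cons big_nil ?mulr1 -?mul_polyC /= => NE.
- have [n0 n1 n2 d2] : [/\ qn0 f = c, qn1 f = 0 + qd0 f, qn2 f = 0 + qd1 f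
     & qd2 f = - 0] by apply: cubic_coefs; rewrite NE /quadratic; ring.
  rewrite oppr0 in d2; rewrite !mI //.
  have:= qres_lead rf; rewrite d2 eqxx orbF => n20.
  case: (f) n0 n1 n2 d2 n20 rf => /= ? ? ? ? ? ? -> -> -> -> n20 rf.
  by split; apply: (mulIf rf); rewrite divfK //; field; move: n20; rewrite add0r.
- have [n0 n1 n2 d2] : [/\ qn0 f = - (c * x), qn1 f = c + qd0 f,
    qn2 f = 0 + qd1 f & qd2 f = - 0]
    by apply: cubic_coefs; rewrite NE /quadratic; ring.
  rewrite oppr0 in d2; rewrite !mI //.
  have:= qres_lead rf; rewrite d2 eqxx orbF => n20.
  have := dn x; rewrite !inE eqxx => /(_ isT) dx {dn}.
  rewrite !mS //; move: dx; rewrite /qden /qnum !horner_quadratic.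
  case: (f) n0 n1 n2 d2 n20 rf => /= ? ? ? ? ? ? -> -> -> -> n20 rf dx.
  by split; apply: (mulIf rf); rewrite divfK //; rewrite !(mul0r, add0r) in dx n20 *;
    field; rewrite dx n20.
- have [n0 n1 n2 d2] : [/\ qn0 f = c * x * y, qn1 f = - c * (x + y) + qd0 f,
    qn2 f = c + qd1 f & qd2 f = - 0]
    by apply: cubic_coefs; rewrite NE /quadratic; ring.
  rewrite oppr0 in d2; rewrite !mI //.
  have:= qres_lead rf; rewrite d2 eqxx orbF => n20.
  have := dn x; rewrite !inE eqxx => /(_ isT) dx.
  have := dn y; rewrite !inE eqxx orbT => /(_ isT) dy {dn}.
  rewrite !mS //; move: dx dy; rewrite /qden /qnum !horner_quadratic.
  case: (f) n0 n1 n2 d2 n20 rf => /= ? ? ? ? ? ? -> -> -> -> n20 rf dx dy.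
  by split; apply: (mulIf rf); rewrite divfK //; rewrite !(mul0r, add0r) in dx dy *;
    field; rewrite dx dy n20.
- have [n0 n1 n2 d2] : [/\ qn0 f = - (c * x * y * z),
    qn1 f = c * (x * y + x * z + y * z) + qd0 f,
    qn2 f = - c * (x + y + z) + qd1 f & qd2 f = - c]
    by apply: cubic_coefs; rewrite NE /quadratic; ring.
  have := dn x; rewrite !inE eqxx => /(_ isT) dx.
  have := dn y; rewrite !inE eqxx orbT => /(_ isT) dy.
  have := dn z; rewrite !inE eqxx !orbT => /(_ isT) dz {dn}.
  rewrite !mS //; move: dx dy dz.
  rewrite /qden /qnum !horner_quadratic.
  case: (f) n0 n1 n2 d2 rf => /= ? ? ? ? ? ? -> -> -> -> rf dx dy dz.
  by split; apply: (mulIf rf); rewrite divfK //; field; rewrite dx dy dz.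
Qed.
End Multipliers.

(** * Prime ideals and algebraic integers *)

(** A maximal element among the proper ideals containing I is prime: if it
    contains u v but neither u nor v, adding u to it yields the whole ring,
    and multiplying an expression of 1 by v shows that v lies in it. *)
Lemma prime_ideal_above (R : comNzRingType) (I : {pred R}) : idealr_closed I ->
  exists P : prime_idealr R, {subset I <= P}.
Proof.
move=> idI.
pose T := {J : R -> bool | idealr_closed J /\ {subset I <= J}}.
pose le (J1 J2 : T) := `[< {subset sval J1 <= sval J2} >].
have leP (J1 J2 : T) : reflect {subset sval J1 <= sval J2} (le J1 J2).
  by apply: asboolP.
have II : {subset I <= I} by [].
pose I0 : T := exist _ (I : R -> bool) (conj idI II).
have [||A chA|[J [[J0 J1 JM] IJ]] /= maxJ] := @classical_sets.ZL_preorder T I0 le.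
- by move=> J; apply/leP.
- by move=> J1 J2 J3 /leP le12 /leP le23; apply/leP => x /le12 /le23.
- have [[J0 AJ0]|A0] := pselect (exists J, A J); last first.
    by exists I0 => J AJ; case: A0; exists J.
  pose U x := `[< exists2 J, A J & x \in sval J >].
  have UP x : reflect (exists2 J, A J & x \in sval J) (x \in U).
    by apply: asboolP.
  have idU : idealr_closed U.
    split.
    - by apply/UP; exists J0 => //; case: (svalP J0) => -[].
    - by apply/negP => /UP[J _]; case: (svalP J) => -[_ /negP].
    - move=> a x y /UP[J AJ Jx] /UP[K AK Ky].
      have [/leP JK|/leP KJ] := chA J K AJ AK; apply/UP.
        exists K => //; case: (svalP K) => -[_ _ KM] _.
        by apply: KM => //; apply: JK.
      exists J => //; case: (svalP J) => -[_ _ JM] _.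
      by apply: JM => //; apply: KJ.
  have IU : {subset I <= U}.
    by move=> x Ix; apply/UP; exists J0 => //; case: (svalP J0) => _; apply.
  exists (exist _ U (conj idU IU)) => J AJ; apply/leP => x Jx.
  by apply/UP; exists J.
have primeJ : prime_idealr_closed J.
  move=> u v uv; apply/norP => -[/negP uJ /negP vJ].
  pose Ju x := `[< exists2 r, r \in J & exists s, x = r + s * u >].
  have JuP x : reflect (exists2 r, r \in J & exists s, x = r + s * u) (x \in Ju).
    exact: asboolP.
  have Ju0 x : x \in J -> x \in Ju.
    by move=> Jx; apply/JuP; exists x => //; exists 0; rewrite mul0r addr0.
  have [/JuP[r Jr [s e1]]|n1] := boolP (1 \in Ju).
    apply: vJ; rewrite -[v]mul1r e1 mulrDl -mulrA.
    by rewrite mulrC JM // -[_ * _]addr0 JM.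
  have idJu : idealr_closed Ju.
    split=> //; first exact: Ju0.
    move=> a x y /JuP[r Jr [s ->]] /JuP[r' Jr' [s' ->]]; apply/JuP.
    by exists (a * r + r'); [apply/JM | exists (a * s + s'); ring].
  have IJu : {subset I <= Ju} by move=> x /IJ /Ju0.
  have /leP JuJ := maxJ (exist _ Ju (conj idJu IJu)) (asboolT Ju0).
  apply/uJ/JuJ/JuP; exists 0 => //.
  by exists 1; rewrite mul1r add0r.
pose mx := isIdealr.Build R J (And3 J0 J1 JM).
pose mp := isPrimeIdealrClosed.Build R J primeJ.
pose PJ : prime_idealr R := HB.pack J mx mp.
by exists PJ.
Qed.

Section AlgebraicIntegers.

Lemma algint_rmorph (K L : fieldType) (j : {rmorphism K -> L}) x :
  (j x \in @algint L) = (x \in @algint K).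
Proof.
have e (p : {poly int}) : map_poly intr p = map_poly j (map_poly intr p).
  by rewrite -map_poly_comp; apply: eq_map_poly => n /=; rewrite rmorph_int.
apply/asboolP/asboolP => -[p mp rx]; exists p => //.
  by move: rx; rewrite e fmorph_root.
by rewrite e fmorph_root.
Qed.

Lemma algint_root_monic (K : fieldType) (p : {poly K}) x :
  p \is monic -> p \is a polyOver (@algint K) -> root p x -> x \in @algint K.
Proof.
move=> mp ap rx; apply/asboolP; apply: integral_root_monic mp rx _.
by move=> c /(nthP 0)[i _ <-]; apply/asboolP/(polyOverP ap).
Qed.

Lemma intr_eq0_num (L : fieldExtType rat) (n : int) :
  (n%:~R == 0 :> L) = (n == 0).
Proof. by rewrite -(rmorph_int (in_alg L)) fmorph_eq0 intr_eq0. Qed.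

(** If c is the leading coefficient of an integer polynomial of degree n with
    coefficients p_i that vanishes at x, then c x is a root of the monic
    polynomial X^n + sum_(i < n) p_i c^(n - 1 - i) X^i. *)
Lemma clear_denominator (L : fieldExtType rat) (x : L) :
  exists2 c : int, c != 0 & c%:~R * x \in @algint L.
Proof.
have [/polyOver1P[q qE] mq] := (minPolyOver 1 x, monic_minPoly 1 x).
have [p [a a0 pE]] := rat_poly_scale q.
have q0 : q != 0.
  apply: contraTneq mq => q0.
  by rewrite qE q0 map_poly0 monicE lead_coef0 eq_sym oner_eq0.
have p0 : p != 0.
  by apply: contra_neq q0 => p0; rewrite pE p0 map_poly0 scaler0.
have px : root (map_poly intr p) x.
  have := root_minPoly 1 x.
  rewrite qE pE map_polyZ rootZ ?fmorph_eq0 ?invr_eq0 ?intr_eq0 //.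
  rewrite -map_poly_comp; congr (root _ _).
  by apply: eq_map_poly => n /=; rewrite alg_num_field ratr_int.
pose c := lead_coef p; have c0 : c != 0 by rewrite lead_coef_eq0.
exists c => //.
pose n := (size p).-1.
have sp : size p = n.+1 by rewrite /n prednK // size_poly_gt0.
have n0 : (0 < n)%N.
  rewrite lt0n; apply: contraTneq px => n0.
  rewrite (size1_polyC (p := p)) ?sp ?n0 // map_polyC rootC /=.
  by move: c0; rewrite /c lead_coefE -/n n0 intr_eq0_num.
pose P : {poly L} := 'X^n + \poly_(i < n) ((p`_i * c ^+ (n.-1 - i))%:~R).
have sP : (size (\poly_(i < n) ((p`_i * c ^+ (n.-1 - i))%:~R) : {poly L}) <= n)%N.
  exact: size_poly.
apply: (@algint_root_monic _ P).
- by rewrite monicE lead_coefDl ?lead_coefXn // size_polyXn ltnS.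
- rewrite rpredD ?polyOverXn //; apply/polyOverP => i; rewrite coef_poly.
  by case: ifP => _; rewrite ?rpred0 // rpred_int.
- rewrite /root hornerD hornerXn horner_poly.
  rewrite (_ : _ + _ = c%:~R ^+ n.-1 * (map_poly intr p).[x]).
    by rewrite (eqP px) mulr0.
  rewrite (@horner_coef_wide _ n.+1) ?size_map_poly_id0 ?sp // ?intr_eq0_num //.
  rewrite big_ord_recr /= mulrDr [RHS]addrC; congr (_ + _).
    rewrite coef_map /= (_ : p`_n = c) ?lead_coefE // exprMn mulrA -exprSr.
    by rewrite prednK.
  rewrite mulr_sumr; apply: eq_bigr => i _; rewrite coef_map /=.
  have -> : n.-1 = (n.-1 - i + i)%N by rewrite subnK // -ltnS prednK.
  by rewrite addnK exprMn exprD rmorphM rmorphXn /=; ring.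
Qed.

End AlgebraicIntegers.

(** * Reduction modulo a prime *)

Section ResidueMap.
Variables (R : comNzRingType) (P : prime_idealr R).

(** The reduction of an algebraic integer. Unlike [reduction], it is a total
    ring morphism, and all computations modulo P go through it. *)
Definition residue (a : R) : residue_field P := tofrac (residue_class P a).

Fact residue_zmod_morphism : zmod_morphism residue.
Proof. by move=> a b; rewrite /residue /residue_class rmorphB tofracB. Qed.
Fact residue_monoid_morphism : monoid_morphism residue.
Proof.
split; first by rewrite /residue /residue_class rmorph1 tofrac1.
by move=> a b; rewrite /residue /residue_class rmorphM tofracM.
Qed.
HB.instance Definition _ :=
  GRing.isZmodMorphism.Build R (residue_field P) residue residue_zmod_morphism.
HB.instance Definition _ :=
  GRing.isMonoidMorphism.Build R (residue_field P) residue
    residue_monoid_morphism.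

Lemma residue_eq0 a : (residue a == 0) = (a \in P).
Proof.
rewrite /residue tofrac_eq0 -[a in RHS]subr0 Quotient.idealrBE.
by rewrite /residue_class -[0 in LHS](rmorph0 \pi_({ideal_quot P})).
Qed.
End ResidueMap.

Section Localization.
Variables (L : fieldType) (P : prime_idealr (ring_of_integers L)).
Local Notation O := (ring_of_integers L).

Lemma notin_prime_neq0 (b : O) : b \notin P -> val b != 0 :> L.
Proof.
apply: contraNneq => b0; suff -> : b = 0 by rewrite rpred0.
by apply: val_inj; rewrite b0 rmorph0.
Qed.

Lemma p_integralP x :
  p_integral P x <-> exists a b : O, b \notin P /\ x = val a / val b.
Proof.
split=> [[[a b] bP xE]|[a [b [bP xE]]]]; last by exists (a, b).
by exists a, b.
Qed.

Lemma reduction_spec x : p_integral P x -> exists a b : O,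
  [/\ b \notin P, x = val a / val b
    & reduction P x = residue P a / residue P b].
Proof.
move=> ix; rewrite /reduction; case: pselect => // ix'.
by case: cid2 => -[a b] bP xE; exists a, b.
Qed.

(** The fraction chosen in the definition of the reduction does not matter. *)
Lemma reduction_div (a b : O) : b \notin P ->
  reduction P (val a / val b) = residue P a / residue P b.
Proof.
move=> bP; have [|a' [b' [b'P /eqP e ->]]] := @reduction_spec (val a / val b).
  by apply/p_integralP; exists a, b.
move: e; rewrite eqr_div ?notin_prime_neq0 // -!rmorphM (inj_eq val_inj).
move=> /eqP e.
by apply/eqP; rewrite eqr_div ?residue_eq0 // -!rmorphM e.
Qed.

(** With one denominator t for all its coefficients, a coefficient vector is the
    multiple by 1 / t of a vector of algebraic integers, and its reduction is
    the corresponding multiple of the residues. *)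
Lemma common_denominator (s : seq L) : (forall x, x \in s -> p_integral P x) ->
  exists2 t : O, t \notin P &
    forall x, x \in s -> exists a : O, x = val a / val t.
Proof.
elim: s => [|x s IH] ints.
  by exists 1; rewrite ?idealr1.
have [t tP st] := IH (fun y ys => ints y (mem_behead (s := x :: s) ys)).
have /p_integralP[a [b [bP xE]]] := ints x (mem_head _ _).
exists (b * t); first by rewrite prime_idealrM negb_or bP.
move=> y; rewrite inE => /predU1P[->|/st[c ->]].
  exists (a * t); rewrite xE !rmorphM; field.
  by rewrite !notin_prime_neq0.
exists (c * b); rewrite !rmorphM; field.
by rewrite !notin_prime_neq0.
Qed.

Lemma p_integral_int (a : O) : p_integral P (val a).
Proof. by apply/p_integralP; exists a, 1; rewrite idealr1 rmorph1 divr1. Qed.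

End Localization.

(** The denominators of x form an ideal, proper when x is not an algebraic
    integer, and nonzero by [clear_denominator]. A fraction for x at a prime
    above this ideal has its denominator both outside and inside the prime. *)
Lemma algint_of_p_integral (L : fieldExtType rat) (x : L) :
    (forall P : prime_idealr (ring_of_integers L),
        (exists2 y, y \in P & y != 0) -> p_integral P x) ->
  x \in @algint L.
Proof.
move=> xint; apply/negPn/negP => xN.
pose I : {pred ring_of_integers L} := fun a => val a * x \in @algint L.
have IE a : (a \in I) = (val a * x \in @algint L) by [].
have idI : idealr_closed I.
  split=> [||a u v]; rewrite !IE ?rmorph0 ?mul0r ?rpred0 ?rmorph1 ?mul1r //.
  move=> Iu Iv; rewrite rmorphD rmorphM mulrDl -mulrA.
  by apply: rpredD => //; apply: rpredM => //; apply: int_valP.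
have [P IP] := prime_ideal_above idI.
have [c c0 cx] := clear_denominator x.
have [|a [b [bP xE]]] := (p_integralP P x).1 (xint P _).
  exists (c%:~R); first by apply: IP; rewrite IE rmorph_int.
  by rewrite -(inj_eq val_inj) rmorph_int rmorph0 intr_eq0_num.
move/negP: bP; apply; apply: IP.
rewrite IE xE mulrC divfK; first exact: int_valP.
apply: contraNneq xN => b0; by rewrite xE b0 invr0 mulr0 rpred0.
Qed.

Section GoodReduction.
Variable L : fieldExtType rat.
Local Notation O := (ring_of_integers L).
Implicit Type P : prime_idealr O.

Lemma reduction_coef P (A : {poly L}) i :
  (map_poly (reduction P) A)`_i = reduction P A`_i.
Proof.
rewrite coef_map_id0 //.
have -> : 0 = val (0 : O) / val (1 : O) :> L by rewrite rmorph0 mul0r.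
by rewrite reduction_div ?idealr1 // rmorph0 mul0r.
Qed.

Lemma map_quadratic_reduction P (x2 x1 x0 : L) :
  map_poly (reduction P) (quadratic x2 x1 x0)
    = quadratic (reduction P x2) (reduction P x1) (reduction P x0).
Proof.
rewrite [LHS]quadratic_coef ?reduction_coef ?coef_quadratic //.
by rewrite (leq_trans (size_poly _ _)) // size_quadratic.
Qed.

(** After clearing denominators outside P, the resultant is an algebraic
    integer whose residue is nonzero because the reduced map still has degree
    2; dividing the integral numerators by it stays P-integral. *)
Lemma good_reduction_sigma P (h : quadmap L) : qres h != 0 ->
    good_reduction_at P (qfrac h) ->
  p_integral P (qinv1 h) /\ p_integral P (qinv2 h).
Proof.
move=> rh [A [B [B0 cAB hE [intAB _]]]]; rewrite rdegree_qfrac // => deg.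
have [c c0 [nE dE]] := rnum_rdenP B0 cAB.
have [c' c'0 [nE' dE']] := rnum_rden_qfrac rh.
have sz (D D' : {poly L}) :
    c *: D = c' *: D' -> (size D' <= 3)%N -> (size D <= 3)%N.
  by move=> /(congr1 (fun p : {poly L} => size p)); rewrite !size_scale // => ->.
have sA : (size A <= 3)%N.
  by apply: sz (size_quadratic _ _ _); rewrite -nE -hE nE'.
have sB : (size B <= 3)%N.
  by apply: sz (size_quadratic _ _ _); rewrite -dE -hE dE'.
pose f := quadmap_of A B.
have nf : qnum f = A by apply: qnum_of.
have df : qden f = B by apply: qden_of.
have hf : qfrac h = qfrac f by rewrite hE /qfrac nf df.
have rf : qres f != 0.
  have := rdegree_qfrac rh; rewrite hE rdegreeE nE dE !size_scale // -nf -df.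
  rewrite -pair_degree_coprime ?nf ?df // -nf -df.
  by move/pair_degree_quadmap.
have [u u0 ->] := qfrac_inj rf rh (esym hf).
have [-> ->] := qinv_scale f u0.
have [|t tP tint] := @common_denominator _ P
   [:: qn2 f; qn1 f; qn0 f; qd2 f; qd1 f; qd0 f].
  by move=> x; rewrite !inE; do 5?[case/orP]; move=> /eqP -> /=;
     [exact: (intAB 2%N).1|exact: (intAB 1%N).1|exact: (intAB 0%N).1
     |exact: (intAB 2%N).2|exact: (intAB 1%N).2|exact: (intAB 0%N).2].
have [g fg] : exists g : quadmap O, f = qscale (val t)^-1 (qmap val g).
  have {}tint x : x \in [:: qn2 f; qn1 f; qn0 f; qd2 f; qd1 f; qd0 f] ->
      exists a : O, x = (val t)^-1 * val a.
    by move=> /tint[a ->]; exists a; rewrite mulrC.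
  have [|n2 e2] := tint (qn2 f); first by rewrite !inE eqxx.
  have [|n1 e1] := tint (qn1 f); first by rewrite !inE eqxx !orbT.
  have [|n0 e0] := tint (qn0 f); first by rewrite !inE eqxx !orbT.
  have [|d2 e2'] := tint (qd2 f); first by rewrite !inE eqxx !orbT.
  have [|d1 e1'] := tint (qd1 f); first by rewrite !inE eqxx !orbT.
  have [|d0 e0'] := tint (qd0 f); first by rewrite !inE eqxx !orbT.
  by exists (QuadMap n2 n1 n0 d2 d1 d0); congr QuadMap.
have t0 := notin_prime_neq0 tP.
have fgr : qmap (reduction P) f = qscale (residue P t)^-1 (qmap (residue P) g).
  by rewrite fg; case: (g) => * /=; congr QuadMap;
    rewrite [_^-1 * val _]mulrC reduction_div // mulrC.
have rg : residue P (qres g) != 0.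
  have : pair_degree (qnum (qmap (reduction P) f))
      (qden (qmap (reduction P) f)) = 2%N.
    by rewrite -deg -nf -df !map_quadratic_reduction; case: (f).
  move/pair_degree_quadmap; rewrite fgr qres_scale qres_map.
  by rewrite mulf_eq0 negb_or => /andP[].
rewrite residue_eq0 in rg.
have t'0 : (val t)^-1 != 0 by rewrite invr_eq0.
have [] := qinv_scale (qmap val g) t'0; rewrite -fg => -> ->.
rewrite /qinv1 /qinv2 qres_map qsigma1_map qsigma2_map.
by split; apply/p_integralP; [exists (qsigma1 g)|exists (qsigma2 g)];
  exists (qres g).
Qed.

Lemma good_reduction_integral (h : quadmap L) : qres h != 0 ->
    good_reduction (qfrac h) ->
  qinv1 h \in @algint L /\ qinv2 h \in @algint L.
Proof.
move=> rh gh; split; apply: algint_of_p_integral => P P0.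
  exact: (good_reduction_sigma rh (gh P P0)).1.
exact: (good_reduction_sigma rh (gh P P0)).2.
Qed.

Lemma integral_good_reduction (g : quadmap O) : qn2 g = 1 -> qres g = 1 ->
  good_reduction (qfrac (qmap val g : quadmap L)).
Proof.
move=> g1 rg P _; set f : quadmap L := qmap val g.
have rf : qres f != 0 by rewrite qres_map rg rmorph1 oner_neq0.
have coefs i :
    exists a b, (qnum f)`_i = val (a : O) /\ (qden f)`_i = val (b : O).
  exists ([:: qn0 g; qn1 g; qn2 g]`_i), ([:: qd0 g; qd1 g; qd2 g]`_i).
  rewrite !coef_quadratic /f; case: (g) => *.
  by case: i => [|[|[|i]]] //=; rewrite ?nth_nil; split; rewrite ?rmorph0.
have red a : reduction P (val (a : O)) = residue P a.
  have -> : val a = val a / val (1 : O) by rewrite rmorph1 divr1.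
  by rewrite reduction_div ?idealr1 // rmorph1 divr1.
exists (qnum f), (qden f); split.
- exact: qden_neq0.
- exact: qres_coprime.
- by [].
- split=> [i|].
    by have [a [b [-> ->]]] := coefs i; split; apply: p_integral_int.
  exists 2%N; left; rewrite coef_quadratic /f; case: (g) g1 => /= ? ? ? ? ? ? ->.
  by exists (1, 1); rewrite ?idealr1 // !rmorph1 divr1.
- rewrite rdegree_qfrac //.
  have -> : map_poly (reduction P) (qnum f) = qnum (qmap (residue P) g).
    by rewrite map_quadratic_reduction /f; case: (g) => * /=; rewrite !red.
  have -> : map_poly (reduction P) (qden f) = qden (qmap (residue P) g).
    by rewrite map_quadratic_reduction /f; case: (g) => * /=; rewrite !red.
  by apply/pair_degree_quadmap; rewrite qres_map rg rmorph1 oner_neq0.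
Qed.
End GoodReduction.

(** * The integral normal form *)

Section Conjugacy.
Variable F : fieldType.
Implicit Types f g h : quadmap F.

(** The factor u allows for coefficient vectors that represent the same map. *)
Definition qconjugate f g := exists a b c d u : F,
  [/\ a * d - b * c != 0, u != 0 & g = qscale u (qconj a b c d f)].

Lemma qconjugate_trans f g h :
  qconjugate f g -> qconjugate g h -> qconjugate f h.
Proof.
move=> [a [b [c [d [u [D0 u0 ->]]]]]] [a' [b' [c' [d' [u' [D0' u0' ->]]]]]].
exists (a * a' + b * c'), (a * b' + b * d').
exists (c * a' + d * c'), (c * b' + d * d').
exists (u' * u); split; last 1 first.
- by rewrite -qconjM; case: (qconj _ _ _ _ f) => * /=; congr QuadMap; ring.
- have -> : (a * a' + b * c') * (c * b' + d * d')
    - (a * b' + b * d') * (c * a' + d * c')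
    = (a * d - b * c) * (a' * d' - b' * c') by ring.
  exact: mulf_neq0.
- exact: mulf_neq0.
Qed.

Lemma qres_conjugate f g : qconjugate f g -> qres f != 0 -> qres g != 0.
Proof.
move=> [a [b [c [d [u [D0 u0 ->]]]]]] rf.
by rewrite qres_scale qres_conj !mulf_neq0 ?expf_neq0.
Qed.

Lemma qinv_conjugate f g : qconjugate f g ->
  qinv1 g = qinv1 f /\ qinv2 g = qinv2 f.
Proof.
move=> [a [b [c [d [u [D0 u0 ->]]]]]].
have [-> ->] := qinv_scale (qconj a b c d f) u0.
by rewrite /qinv1 /qinv2 qres_conj qsigma1_conj qsigma2_conj !divMM ?expf_neq0.
Qed.

Lemma qfrac_conjugate f g : qres f != 0 -> qconjugate f g ->
  exists2 M : 'M[F]_2, M \in unitmx & qfrac g = rconj M (qfrac f).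
Proof.
move=> rf [a [b [c [d [u [D0 u0 ->]]]]]].
pose M : 'M[F]_2 := \matrix_(i, j)
  if i == 0 then (if j == 0 then a else b) else (if j == 0 then c else d).
have uM : M \in unitmx by rewrite unitmxE det_mx22 !mxE /= unitfE.
by exists M; rewrite // qfrac_scale // rconj_qfrac // /mxconj !mxE.
Qed.
End Conjugacy.

(** The coordinate change z |-> x + 1 / z = (x z + 1) / z brings the fixed
    point x to infinity. *)
Lemma fixed_at_infinity (F : closedFieldType) (f : quadmap F) :
  exists2 g, qconjugate f g & qd2 g = 0.
Proof.
have [d2|d2] := eqVneq (qd2 f) 0.
  exists f => //; exists 1, 0, 0, 1, 1; rewrite mul1r mul0r subr0 oner_eq0.
  by split=> //; case: (f) => * /=; congr QuadMap; ring.
have [x rx] : exists x, root (qnum f - 'X * qden f) x.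
  apply/closed_rootP; apply: contra_neqN d2 => /size_poly1P[c _ e].
  have := coef_cubic f 3; rewrite e coefC => /eqP.
  by rewrite eq_sym oppr_eq0 => /eqP.
exists (qscale 1 (qconj x 1 1 0 f)).
  by exists x, 1, 1, 0, 1; rewrite mulr0 mul1r sub0r oppr_eq0 oner_eq0.
move: rx => /rootP; rewrite hornerD hornerN hornerM hornerX !horner_quadratic.
case: (f) => /= n2 n1 n0 d2' d1 d0 e.
by rewrite -[RHS]oppr0 -[in RHS]e; ring.
Qed.

(** Once infinity is fixed, a finite fixed point can be translated to 0, and a
    dilation normalizes the result. Without a finite fixed point A - z B is
    a constant c, and the map is z + c / B: translating the zero of B to 0 and
    dilating gives z + 1 / z. *)
Lemma conjugate_fixed_form (f : quadmap algC) : qres f != 0 ->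
  (exists l1 l2, qconjugate f (QuadMap 1 l2 0 0 l1 1)) \/
  qconjugate f (QuadMap 1 0 1 0 1 0).
Proof.
move=> rf; have [g fg d2] := fixed_at_infinity f.
have rg := qres_conjugate fg rf.
have := qres_lead rg; rewrite d2 eqxx orbF => n2.
have [/closed_rootP[x rx]|s1] := boolP (size (qnum g - 'X * qden g) != 1).
  left.
  have [h fh [d2h n0h]] : exists2 h, qconjugate f h & qd2 h = 0 /\ qn0 h = 0.
    exists (qscale 1 (qconj 1 x 0 1 g)).
      apply: qconjugate_trans fg _; exists 1, x, 0, 1, 1.
      by rewrite mulr0 mulr1 subr0 oner_eq0.
    move: rx => /rootP; rewrite hornerD hornerN hornerM hornerX !horner_quadratic.
    case: (g) d2 => /= n2' n1 n0 d2' d1 d0 -> e.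
    by split; [ring | rewrite -[RHS]e; ring].
  have rh := qres_conjugate fh rf.
  have := qres_lead rh; rewrite d2h eqxx orbF => n2h.
  have d0h : qd0 h != 0.
    apply: contra_neq rh; case: (h) d2h n0h => /= ? ? ? ? ? ? -> -> ->; ring.
  exists (qd1 h / qn2 h), (qn1 h / qd0 h); apply: qconjugate_trans fh _.
  exists (qd0 h / qn2 h), 0, 0, 1, (qn2 h / qd0 h ^+ 2).
  rewrite mul0r subr0 mulr1 !mulf_neq0 ?invr_eq0 ?expf_neq0 //; split=> //.
  case: (h) d2h n0h n2h d0h => /= ? ? ? ? ? ? -> -> n2h d0h.
  by congr QuadMap; field; rewrite ?n2h.
right; apply: qconjugate_trans fg _.
move: s1; rewrite negbK => /size_poly1P[c c0 e].
have n0 : qn0 g != 0 by have := coef_cubic g 0; rewrite e coefC /= => <-.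
have d0 : qd0 g = qn1 g.
  by have := coef_cubic g 1; rewrite e coefC /= => /esym/subr0_eq ->.
have d1 : qd1 g = qn2 g.
  by have := coef_cubic g 2; rewrite e coefC /= => /esym/subr0_eq ->.
pose s := sqrtC (qn0 g / qn2 g).
have s2 : s ^+ 2 = qn0 g / qn2 g by apply: sqrtCK.
have s0 : s != 0 by rewrite sqrtC_eq0 mulf_neq0 ?invr_eq0.
exists s, (- qn1 g / qn2 g), 0, 1, (qn0 g)^-1.
rewrite mulr0 mulr1 subr0 invr_eq0; split=> //; clearbody s.
have n0E : qn0 g = s ^+ 2 * qn2 g by rewrite s2 divfK.
case: (g) d2 n2 n0 d0 d1 n0E {s2} => /= ? ? ? ? ? ? -> n2 n0 -> -> ->.
by congr QuadMap; field; rewrite ?n2 ?s0.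
Qed.

Definition qall (R : Type) (S : R -> Prop) (f : quadmap R) : Prop :=
  [/\ S (qn2 f), S (qn1 f) & S (qn0 f)] /\
  [/\ S (qd2 f), S (qd1 f) & S (qd0 f)].

Lemma algint_sqrt (x : algC) : x ^+ 2 \in @algint algC -> x \in @algint algC.
Proof.
move=> x2; apply: (@algint_root_monic _ ('X^2 - (x ^+ 2)%:P)).
- rewrite monicE lead_coefDl ?lead_coefXn // size_polyXn size_polyN ltnS.
  by rewrite (leq_trans (size_polyC_leq1 _)).
- by rewrite rpredB ?polyOverXn ?polyOverC.
- by rewrite /root !hornerE subrr.
Qed.

Lemma algint_cubic (s1 s2 s3 x : algC) :
    s1 \in @algint algC -> s2 \in @algint algC -> s3 \in @algint algC ->
    x ^+ 3 - s1 * x ^+ 2 + s2 * x - s3 = 0 -> x \in @algint algC.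
Proof.
move=> i1 i2 i3 e; pose q := quadratic (- s1) s2 (- s3).
apply: (@algint_root_monic _ ('X^3 + q)).
- by rewrite monicE lead_coefDl ?lead_coefXn // size_polyXn ltnS size_quadratic.
- rewrite rpredD ?polyOverXn //; apply/polyOverP => i; rewrite coef_quadratic.
  by case: i => [|[|[|i]]] /=; rewrite ?nth_nil ?rpredN ?rpred0.
- by rewrite /root hornerD horner_quadratic hornerXn -e; apply/eqP; ring.
Qed.

(** The multipliers are l1 at infinity, l2 at 0 and l3. Conjugating
    z (z + l2) / (l1 z + 1) by z |-> r z - l2, where r^2 = 1 - l1 l2, makes the
    resultant 1, and the coefficients stay integral because (l1 - 1) / r is a
    square root of 1 - l1 l3. *)
Lemma conjugate_integral_form (f : quadmap algC) : qres f != 0 ->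
    qinv1 f \in @algint algC -> qinv2 f \in @algint algC ->
  exists g, [/\ qconjugate f g, qn2 g = 1, qres g = 1
              & qall (fun x => x \in @algint algC) g].
Proof.
move=> rf i1 i2; case: (conjugate_fixed_form rf) => [[l1 [l2 fg]]|fg]; last first.
  exists (QuadMap 1 0 1 0 1 0); split=> //; first by rewrite /=; ring.
  by rewrite /qall /= !rpred0 !rpred1.
have := qres_conjugate fg rf; have := qinv_conjugate fg.
set g := QuadMap _ _ _ _ _ _ in fg *.
have resE : qres g = 1 - l1 * l2 by rewrite /=; ring.
rewrite /qinv1 /qinv2 resE => -[e1 e2] rho0.
set rho := 1 - l1 * l2 in rho0 e1 e2.
pose l3 := (2%:R - l1 - l2) / rho.
have {}e1 : qinv1 f = l1 + l2 + l3.
  by rewrite /qinv1 -e1 /l3 /=; rewrite /rho in rho0 *; field.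
have {}e2 : qinv2 f = l1 * l2 + l1 * l3 + l2 * l3.
  by rewrite /qinv2 -e2 /l3 /=; rewrite /rho in rho0 *; field.
have e3 : l1 * l2 * l3 = qinv1 f - 2%:R.
  by rewrite e1 /l3; rewrite /rho in rho0 *; field.
have i3 : l1 * l2 * l3 \in @algint algC by rewrite e3 rpredB ?rpred_nat.
rewrite e1 in i1; rewrite e2 in i2.
(* The cubic with roots l1, l2, l3 has integral coefficients. *)
have il x : (x - l1) * (x - l2) * (x - l3) = 0 -> x \in @algint algC.
  move=> xl; apply: algint_cubic i1 i2 i3 _; rewrite -xl; ring.
have il1 : l1 \in @algint algC by apply: il; rewrite subrr !mul0r.
have il2 : l2 \in @algint algC by apply: il; rewrite subrr mulr0 mul0r.
have il3 : l3 \in @algint algC by apply: il; rewrite subrr mulr0.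
pose r := sqrtC rho; have r2 : r ^+ 2 = rho by apply: sqrtCK.
have r0 : r != 0 by rewrite sqrtC_eq0.
clearbody r; pose r' := (l1 - 1) / r.
have r'2 : r' ^+ 2 = 1 - l1 * l3.
  by rewrite /r' expr_div_n r2 /l3; rewrite /rho in rho0 *; field.
have r'r : r' * r = l1 - 1 by rewrite divfK.
clearbody l3 r'.
have ir : r \in @algint algC.
  by apply: algint_sqrt; rewrite r2 rpredB ?rpred1 ?rpredM.
have ir' : r' \in @algint algC.
  by apply: algint_sqrt; rewrite r'2 rpredB ?rpred1 ?rpredM.
exists (QuadMap 1 (l2 * r') l2 0 l1 r); split=> //.
- apply: qconjugate_trans fg _; exists r, (- l2), 0, 1, (r ^+ 2)^-1.
  rewrite mulr1 mulr0 subr0 invr_eq0 expf_neq0 //; split=> //.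
  have rE : 1 = r ^+ 2 + l1 * l2 by rewrite r2 /rho subrK.
  have l1E : l1 = r' * r + 1 by rewrite r'r subrK.
  have e : 1 - l2 * (r' * r + 1) = r ^+ 2 by rewrite r2 /rho -l1E; ring.
  rewrite /= l1E; congr QuadMap.

  1,2,4,5: by field.
  + transitivity (r ^- 2 * (l2 * (1 - l2 * (r' * r + 1)))); last by ring.
    by rewrite e mulrCA mulVf ?mulr1 ?expf_neq0.
  + transitivity (r ^- 2 * (r * (1 - l2 * (r' * r + 1)))); last by ring.
    by rewrite e mulrCA mulVf ?mulr1 ?expf_neq0.
- have l1E : l1 = r' * r + 1 by rewrite r'r subrK.
  transitivity (r ^+ 2 + l1 * l2); last by rewrite r2 /rho subrK.
  by rewrite /= l1E; ring.
- by rewrite /qall /= il1 ir il2 rpredM ?rpred0 ?rpred1.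
Qed.

(** Adjoining a rational basis of K together with s yields a number field
    through which iota factors. *)
Lemma number_field_extension (K : fieldExtType rat)
    (iota : {rmorphism K -> algC}) (s : seq algC) :
  exists (L : fieldExtType rat) (e : {rmorphism K -> L})
    (j : {rmorphism L -> algC}),
    j \o e =1 iota /\ forall x, x \in s -> exists y, j y = x.
Proof.
pose b := vbasis {:K}.
have [L [j [t tE _]]] := num_field_exists (map iota b ++ s).
have sj x : x \in map iota b ++ s -> exists y, j y = x.
  by rewrite -tE => /mapP[y _ ->]; exists y.
have ex x : exists y, j y = iota x.
  rewrite (coord_vbasis (memvf x)).
  have /fin_all_exists[y yE] (i : 'I_(\dim {:K})) : exists y, j y = iota b`_i.
    by apply: sj; rewrite mem_cat map_f // mem_nth // size_tuple.
  exists (\sum_i coord b i x *: y i); rewrite !rmorph_sum; apply: eq_bigr => i _.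
  by rewrite !rmorphZ_num yE.
pose e0 x := sval (cid (ex x)).
have e0E x : j (e0 x) = iota x by rewrite /e0; case: cid.
have e0B : zmod_morphism e0.
  by move=> x y; apply: (fmorph_inj j); rewrite rmorphB !e0E rmorphB.
have e0M : monoid_morphism e0.
  split=> [|x y]; apply: (fmorph_inj j); first by rewrite e0E !rmorph1.
  by rewrite rmorphM !e0E rmorphM.
pose e : {rmorphism K -> L} := HB.pack e0
  (GRing.isZmodMorphism.Build K L e0 e0B)
  (GRing.isMonoidMorphism.Build K L e0 e0M).
exists L, e, j; split=> [x|x xs]; first exact: e0E.
by apply: sj; rewrite mem_cat xs orbT.
Qed.

Theorem corollary4p5 (K : fieldExtType rat) (iota : {rmorphism K -> algC})
    (hK : principal_ideal_ring (ring_of_integers K))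
    (phi : {fraction {poly K}}) (hphi : rdegree phi = 2%N) :
  potential_good_reduction iota phi <-> integral_moduli iota phi.
Proof.
have [f [phiE _ _ rf]] := rdegree2_quadmap hphi.
have rfC : qres (qmap iota f) != 0 by rewrite qres_map fmorph_eq0.
have phiC : rmap iota phi = qfrac (qmap iota f) by rewrite phiE rmap_qfrac.
rewrite /integral_moduli phiC.
have [-> ->] := sigma_qfrac rfC; rewrite qinv1_map qinv2_map.
split.
  case=> M uM [L [e [j [psi [je psiE gpsi]]]]].
  rewrite phiC rconj_qfrac // in psiE.
  have rM := mxconj_neq0 uM rfC.
  have dpsi : rdegree psi = 2%N by rewrite -(rdegree_map j) psiE rdegree_qfrac.
  have [h [psih _ _ rh]] := rdegree2_quadmap dpsi.
  have rhC : qres (qmap j h) != 0 by rewrite qres_map fmorph_eq0.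
  rewrite psih rmap_qfrac // in psiE.
  have [c c0 hE] := qfrac_inj rhC rM psiE.
  have [] := qinv_scale (qmap j h) c0; rewrite -hE.
  have [-> ->] := qinv_conj (qmap iota f) uM.
  rewrite !qinv1_map !qinv2_map => e1 e2.
  rewrite psih in gpsi; have [] := good_reduction_integral rh gpsi.
  rewrite -!(algint_rmorph j) -e1 -e2 !algint_rmorph => i1 i2.
  by exists (RingInt i1), (RingInt i2).
case=> s1 [s2 [e1 e2]].
have i1 : qinv1 (qmap iota f) \in @algint algC.
  by rewrite qinv1_map -e1 algint_rmorph; apply: int_valP.
have i2 : qinv2 (qmap iota f) \in @algint algC.
  by rewrite qinv2_map -e2 algint_rmorph; apply: int_valP.
have [g [fg g1 rg [[a2 a1 a0] [b2 b1 b0]]]] := conjugate_integral_form rfC i1 i2.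
have [M uM gE] := qfrac_conjugate rfC fg.
have [L [e [j [je sj]]]] := number_field_extension iota
  [:: qn2 g; qn1 g; qn0 g; qd2 g; qd1 g; qd0 g].
have lift x : x \in @algint algC ->
    x \in [:: qn2 g; qn1 g; qn0 g; qd2 g; qd1 g; qd0 g] ->
    exists y : ring_of_integers L, j (val y) = x.
  by move=> ix /sj[y yE]; rewrite -yE algint_rmorph in ix; exists (RingInt ix).
have [h hE] : exists h : quadmap (ring_of_integers L), qmap j (qmap val h) = g.
  have [|n2 e2'] := lift (qn2 g) a2; first by rewrite !inE eqxx.
  have [|n1 en1] := lift (qn1 g) a1; first by rewrite !inE eqxx !orbT.
  have [|n0 en0] := lift (qn0 g) a0; first by rewrite !inE eqxx !orbT.
  have [|d2 ed2] := lift (qd2 g) b2; first by rewrite !inE eqxx !orbT.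
  have [|d1 ed1] := lift (qd1 g) b1; first by rewrite !inE eqxx !orbT.
  have [|d0 ed0] := lift (qd0 g) b0; first by rewrite !inE eqxx !orbT.
  exists (QuadMap n2 n1 n0 d2 d1 d0).
  by rewrite /= e2' en1 en0 ed2 ed1 ed0; case: (g).
have valj_inj : injective (j \o val : ring_of_integers L -> algC).
  exact: inj_comp (fmorph_inj j) val_inj.
have h1 : qn2 h = 1.
  by apply: valj_inj; rewrite /= !rmorph1 -[RHS]g1 -hE; case: (h).
have rh : qres h = 1.
  apply: valj_inj; change (j (val (qres h)) = j (val (1 : ring_of_integers L))).
  by rewrite -!qres_map hE rg !rmorph1.
exists M => //; exists L, e, j, (qfrac (qmap val h)); split=> //.
  by rewrite phiC -gE rmap_qfrac ?hE // qres_map rh rmorph1 oner_neq0.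
exact: integral_good_reduction.
Qed.
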